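(* There exists a universal constant $C>0$ such that the following holds in the setting described in the context. Let $\delta\in(0,1)$. If $$m_t \;\geq\; C\,\nu_{k,t}^2\,\delta^{-2}\, s\,\log^2(s)\,\log(k)\,\log(nT),\qquad t=0,1,\dots,T-1,$$ then with probability at least $1-(nT)^{-\log^2(s)\log(k)}$ the restricted isometry constant $\delta_s$ of order $s$ of the matrix $\mathbf{\Psi}\mathbf{S}\tilde{\mathbf{U}}_{k,T}$ satisfies $\delta_s\leq 3\delta$.
   Context: Write $[n]=\{1,\dots,n\}$, let $\log$ be the natural logarithm and $\log^2(s)=(\log s)^2$. Graph and diffusion. $\mathcal G$ is a weighted undirected connected graph on $n$ vertices with symmetric weighted adjacency matrix (entries $w_{ij}>0$ on edges and $0$ otherwise), degree matrix $\mathbf D$ and Laplacian $\mathbf L=\mathbf D-(w_{ij})_{i,j}$. All eigenvalues of $\mathbf L$ are assumed simple: $0=\sigma_1<\sigma_2<\dots<\sigma_n$, with orthonormal (real) eigenvectors $\mathbf u_1,\dots,\mathbf u_n$. Fix $\Delta t>0$; the evolution operator is $\mathbf A=e^{-\Delta t\,\mathbf L}$, with eigenvalues $\lambda_i=e^{-\Delta t\,\sigma_i}$. Space-time matrix. Let $1\le s\le k\le n$ and $T\ge 1$ be integers and $f_T(\lambda)=\big(\sum_{j=0}^{T-1}\lambda^{2j}\big)^{1/2}$. The matrix $\tilde{\mathbf U}_{k,T}\in\mathbb R^{Tn\times k}$ has entries $$(\tilde{\mathbf U}_{k,T})_{tn+i,\,j}=\frac{\lambda_j^t}{f_T(\lambda_j)}\,\mathbf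 u_j(i),\qquad t=0,\dots,T-1,\ i\in[n],\ j\in[k];$$ its columns are orthonormal. Random sampling. For each $t\in\{0,\dots,T-1\}$, $\mathbf p_t$ is a probability distribution on $[n]$ with all $\mathbf p_t(i)>0$, and $m_t\ge 1$ is an integer. The indices $\omega_{t,i}$ ($0\le t\le T-1$, $i\in[m_t]$) are independent random elements of $[n]$, with $\mathbb P(\omega_{t,i}=j)=\mathbf p_t(j)$ (sampling with replacement). Let $M=\sum_{t}m_t$. $\mathbf S_t\in\mathbb R^{m_t\times n}$ has $\mathbf S_t(i,j)=1$ if $j=\omega_{t,i}$ and $0$ otherwise, and $\mathbf S\in\mathbb R^{M\times Tn}$ is block diagonal with blocks $\mathbf S_0,\dots,\mathbf S_{T-1}$. The reweighting matrix is $\mathbf\Psi=\mathbf P_\Omega^{-1/2}\mathbf W^{1/2}\in\mathbb R^{M\times M}$, where $\mathbf P_\Omega$ is the diagonal matrix whose diagonal entry at the row indexed by $(t,i)$ is $\mathbf p_t(\omega_{t,i})$, and $\mathbf W$ is the diagonal matrix whose diagonal entry at row $(t,i)$ is $1/m_t$. Thus the row $(t,i)$ of $\mathbf\Psi\mathbf S\tilde{\mathbf U}_{k,T}$ is the $(tn+\omega_{t,i})$-th row of $\tilde{\mathbf U}_{k,T}$ divided by $\sqrt{m_t\,\mathbf p_t(\omega_{t,i})}$. Coherence. The dynamic spectral graph weighted coherence at time $t$ is $$\nu_{k,t}=\max_{i\in[n],\,j\in[k]}\frac{|(\tilde{\mathbf U}_{k,T})_{tn+i,\,j}|}{\sqrt{\mathbf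 p_t(i)}}.$$ Restricted isometry constant. For a matrix $\mathbf\Phi$ with $k$ columns, $\delta_s$ is the smallest $\delta_s\ge0$ such that $(1-\delta_s)\|\mathbf z\|_2^2\le\|\mathbf\Phi\mathbf z\|_2^2\le(1+\delta_s)\|\mathbf z\|_2^2$ for all $\mathbf z\in\mathbb R^k$ with at most $s$ nonzero entries. *)

(* Defs.v *)
From HB Require Import structures.
From mathcomp Require Import all_boot all_order all_algebra.
From mathcomp Require Import all_classical all_reals all_analysis.
From mathcomp Require Import lra.

Set Implicit Arguments.
Unset Strict Implicit.
Unset Printing Implicit Defensive.

Import Order.TTheory GRing.Theory Num.Theory.
Import numFieldNormedType.Exports.

Local Open Scope classical_set_scope.
Local Open Scope ring_scope.

Section Graph.
Variables (R : realType) (n : nat).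
Implicit Types (w : 'M[R]_n) (sigma : 'I_n -> R) (u : 'I_n -> 'cV[R]_n).

(* The edges are the pairs of positive weight. Loops are not excluded: they
   do not change the Laplacian. *)
Definition weighted_graph w : Prop := w^T = w /\ forall i j, 0 <= w i j.

Definition connected_graph w : Prop :=
  forall i j, connect [rel a b | 0 < w a b] i j.

Definition degree_mx w : 'M[R]_n := diag_mx (\row_i \sum_j w i j).

Definition laplacian w : 'M[R]_n := degree_mx w - w.

(* As there are n strictly increasing eigenvalues, all of them are simple and
   they are the whole spectrum. Indices start at 0, so sigma_1 is the value of
   sigma at the index 0. *)
Definition simple_eigensystem (L : 'M[R]_n) sigma u : Prop :=
  [/\ forall i : 'I_n, val i = 0%N -> sigma i = 0,
      forall i j : 'I_n, (i < j)%N -> sigma i < sigma j,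
      forall i, L *m u i = sigma i *: u i
    & forall i j, ((u i)^T *m u j) 0 0 = (i == j)%:R].

(* The eigenvalues of the evolution operator exp(- dt L). *)
Definition diffusion_eigenvalue (dt : R) sigma (i : 'I_n) : R :=
  expR (- (dt * sigma i)).

End Graph.

Section SpaceTime.
Variables (R : realType) (n k T : nat).

Definition fT (x : R) : R := Num.sqrt (\sum_(j < T) x ^+ (2 * j)).

(* The row numbered tn + i is the row i of the block t of the \mxcol; the
   columns are those of the first k eigenvectors. *)
Definition Utilde (lekn : (k <= n)%N) (lam : 'I_n -> R) (u : 'I_n -> 'cV[R]_n) :
    'M[R]_(\sum_(t < T) n, k) :=
  \mxcol_(t < T) \matrix_(i < n, j < k)
    (lam (widen_ord lekn j) ^+ t / fT (lam (widen_ord lekn j))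
     * u (widen_ord lekn j) i 0).

Definition coherence (U : 'M[R]_(\sum_(t < T) n, k)) (p : 'I_T -> 'I_n -> R)
    (t : 'I_T) : R :=
  \big[Num.max/0]_(i < n) \big[Num.max/0]_(j < k)
    (`|submxcol U t i j| / Num.sqrt (p t i)).

End SpaceTime.

Section Sampling.
Variables (R : realType) (n T : nat) (m : 'I_T -> nat).

Definition prob_vector (q : 'I_n -> R) : Prop :=
  (forall i, 0 <= q i) /\ \sum_i q i = 1.

(* [x t i] is the vertex drawn by the i-th sample at time t. *)
Implicit Type x : forall t : 'I_T, 'I_(m t) -> 'I_n.

Definition sampling_block x (t : 'I_T) : 'M[R]_(m t, n) :=
  \matrix_(i < m t, j < n) (j == x t i)%:R.

Definition sampling_mx x : 'M[R]_(\sum_(t < T) m t, \sum_(t < T) n) :=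
  \mxblock_(t < T, t' < T) (if t == t' then sampling_block x t else 0).

Definition P_Omega (p : 'I_T -> 'I_n -> R) x : 'M[R]_(\sum_(t < T) m t) :=
  \mxdiag_(t < T) diag_mx (\row_(i < m t) p t (x t i)).

Definition W_mx : 'M[R]_(\sum_(t < T) m t) :=
  \mxdiag_(t < T) ((m t)%:R^-1)%:M.

(* Real power of a diagonal matrix with positive diagonal. *)
Definition diag_powR N (A : 'M[R]_N) (a : R) : 'M[R]_N :=
  diag_mx (\row_i (A i i `^ a)).

Definition Psi_mx (p : 'I_T -> 'I_n -> R) x : 'M[R]_(\sum_(t < T) m t) :=
  diag_powR (P_Omega p x) (- 2^-1) *m diag_powR W_mx 2^-1.

End Sampling.

Section Independence.
Variables (R : realType) (d : measure_display) (Om : measurableType d).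
Variable P : probability Om R.

(* A finite type is endowed with its discrete sigma-algebra. *)
Definition random_element (F : finType) (X : Om -> F) : Prop :=
  forall A : set F, measurable (X @^-1` A).

Definition mutually_independent (I F : finType) (X : I -> Om -> F) : Prop :=
  forall (J : {set I}) (A : I -> set F),
    (P (\bigcap_(i in [set` J]) (X i @^-1` A i))
     = \prod_(i in J) P (X i @^-1` A i))%E.

(* The [m t] samples at time t have law [p t], and all samples, for all times,
   are independent. *)
Definition random_samples (n T : nat) (m : 'I_T -> nat)
    (p : 'I_T -> 'I_n -> R) (omega : forall t : 'I_T, 'I_(m t) -> Om -> 'I_n) :
    Prop :=
  [/\ forall t (i : 'I_(m t)), random_element (omega t i),
      forall t (i : 'I_(m t)) (j : 'I_n),
        P (omega t i @^-1` [set j]) = (p t j)%:E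
    & mutually_independent
        (fun ti : {t : 'I_T & 'I_(m t)} => omega (tag ti) (tagged ti))].

End Independence.

Section RIP.
Variables (R : realType) (N k : nat).

Definition l2norm q (z : 'cV[R]_q) : R := Num.sqrt (\sum_i z i 0 ^+ 2).

Definition sparse (s : nat) (z : 'cV[R]_k) : Prop :=
  (#|[pred i | z i 0%R != 0%R]| <= s)%N.

Definition RIP_bound (Phi : 'M[R]_(N, k)) (s : nat) (delta : R) : Prop :=
  forall z : 'cV[R]_k, sparse s z ->
    (1 - delta) * l2norm z ^+ 2 <= l2norm (Phi *m z) ^+ 2
      <= (1 + delta) * l2norm z ^+ 2.

(* The infimum is a minimum: see [RIP_constP]. *)
Definition RIP_const (Phi : 'M[R]_(N, k)) (s : nat) : R :=
  inf [set delta | 0 <= delta /\ RIP_bound Phi s delta].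

Lemma l2norm_sqr q (z : 'cV[R]_q) : l2norm z ^+ 2 = \sum_i z i 0 ^+ 2.
Proof. by rewrite sqr_sqrtr // sumr_ge0 // => i _; exact: sqr_ge0. Qed.

Lemma RIP_bound_exists (Phi : 'M[R]_(N, k)) (s : nat) :
  exists delta, 0 <= delta /\ RIP_bound Phi s delta.
Proof.
pose B := \sum_i (\sum_j `|Phi i j|) ^+ 2.
have B0 : 0 <= B by apply: sumr_ge0 => i _; exact: sqr_ge0.
exists (1 + B); split; first by rewrite addr_ge0.
move=> z _; apply/andP; split.
  apply: (@le_trans _ _ 0); last exact: sqr_ge0.
  by rewrite mulr_le0_ge0 ?sqr_ge0 // opprD addrA subrr add0r oppr_le0.
apply: (@le_trans _ _ (B * l2norm z ^+ 2)); last first.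
  by rewrite ler_wpM2r ?sqr_ge0 // addrA lerDr.
rewrite l2norm_sqr mulr_suml; apply: ler_sum => i _.
rewrite -exprMn -[leLHS]real_normK ?num_real // ler_sqr ?nnegrE //; last first.
  by rewrite mulr_ge0 ?sqrtr_ge0 // sumr_ge0.
rewrite mxE mulr_suml; apply: (le_trans (ler_norm_sum _ _ _)).
apply: ler_sum => j _; rewrite normrM ler_wpM2l //.
rewrite -ler_sqr ?nnegrE ?sqrtr_ge0 // l2norm_sqr real_normK ?num_real //.
by rewrite (bigD1 j) //= lerDl sumr_ge0 // => l _; exact: sqr_ge0.
Qed.

Lemma RIP_constP (Phi : 'M[R]_(N, k)) (s : nat) :
  [/\ 0 <= RIP_const Phi s, RIP_bound Phi s (RIP_const Phi s)
    & forall delta, 0 <= delta -> RIP_bound Phi s delta ->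
        RIP_const Phi s <= delta].
Proof.
set S := [set delta | 0 <= delta /\ RIP_bound Phi s delta].
have S0 : S !=set0 by have [x Sx] := RIP_bound_exists Phi s; exists x.
have lbS : has_lbound S by exists 0 => x [].
have hS : has_inf S by split.
split; first by apply: lb_le_inf => // x [].
- move=> z sz; have zge0 := sqr_ge0 (l2norm z).
  suff H e : 0 < e -> (1 - (inf S + e)) * l2norm z ^+ 2
        <= l2norm (Phi *m z) ^+ 2 <= (1 + (inf S + e)) * l2norm z ^+ 2.
    have [z0|zn0] := eqVneq (l2norm z ^+ 2) 0.
      by have := H 1 ltr01; rewrite z0 !mulr0.
    have zgt0 : 0 < l2norm z ^+ 2 by rewrite lt_def zn0.
    apply/andP; split.
      rewrite -ler_pdivlMr //; apply/ler_addgt0Pr => e e0.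
      have /andP[+ _] := H e e0; rewrite -ler_pdivlMr //; lra.
    rewrite -ler_pdivrMr //; apply/ler_addgt0Pr => e e0.
    have /andP[_] := H e e0; rewrite -ler_pdivrMr //; lra.
  move=> e0; have [x [x0 Hx] xlt] := inf_adherent e0 hS.
  have /andP[h1 h2] := Hx z sz; apply/andP; split.
    apply: le_trans h1; apply: ler_wpM2r => //.
    by rewrite lerD2l lerN2 ltW.
  by apply: (le_trans h2); apply: ler_wpM2r => //; rewrite lerD2l ltW.
- by move=> x x0 Hx; exact: ge_inf.
Qed.

End RIP.

(* Main.v *)
Require Import Defs.
From mathcomp Require Import all_boot all_order all_algebra.
From mathcomp Require Import all_classical all_reals all_analysis.
From mathcomp Require Import ring lra.

(**
Let [Z] be the supremum over the [s]-sparse unit vectors [x] of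
[|x^T (Phi^T Phi - 1) x|], which bounds the restricted isometry constant. All
the rows of [Phi] are drawn from the [n T] rescaled rows of [Utilde], whose
entries are bounded by some [K], so that covering numbers only see [log (n T)],
not the number of samples. We bound the moment of [Z] of order [2 q], with [q]
about [log^2 s log k log (n T)], and conclude by Markov's inequality: no
concentration inequality for suprema of empirical processes is needed.

By symmetrization [E Z^(2q)] is controlled by a Rademacher process whose
increments are sub-Gaussian for [sqrt V max_j |<a_j, x - y>|], with
[V = sup_x |Phi x|^2 <= 1 + Z]. The process is discretized by an l2-net of
cardinality [exp (O (s log k))], and then chained over the scales
[K sqrt s / 2^l], [l <= log_2 s + 1], whose nets come from Maurey's empirical
method. In moments of order [2 q] this gives
[E sup^(2q) <= (C K^2 s q V)^q], an inequality that is self-bounding in [Z].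
*)

Set Implicit Arguments.
Unset Strict Implicit.
Unset Printing Implicit Defensive.

Import Order.TTheory GRing.Theory Num.Theory.
Local Open Scope ring_scope.

(** * Convexity of powers and Hoeffding's lemma *)

Section Elementary.
Variable R : realType.
Implicit Types (x y a : R).

(** The tangent of a convex power lies below it. Multiplying the bound by [x] leaves the excess
    [(n + 1) a^n (x - a)^2], which drives the induction. *)
Lemma pow_tangent n x a : 0 <= x -> 0 <= a ->
  a ^+ n.+1 + n.+1%:R * a ^+ n * (x - a) <= x ^+ n.+1.
Proof.
move=> x0 a0; elim: n => [|n ih]; first by rewrite !expr1 expr0 mulr1 mul1r addrC subrK.
have := ler_wpM2l x0 ih; rewrite -exprS => /(le_trans _); apply.
rewrite -subr_ge0 [X in 0 <= X](_ : _ = n.+1%:R * a ^+ n * (x - a) ^+ 2).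
  by rewrite mulr_ge0 ?sqr_ge0 // mulr_ge0 // exprn_ge0.
rewrite !exprS -[n.+2%:R]natr1; ring.
Qed.

(** Averages the tangent inequality at the mean. With total mass below 1, the missing mass acts as
    if placed at the value 0; chaining and the l1 bound on sparse vectors use such weights. *)
Lemma pow_jensen (I : finType) (w x : I -> R) n : (0 < n)%N ->
  (forall i, 0 <= w i) -> \sum_i w i <= 1 -> (forall i, 0 <= x i) ->
  (\sum_i w i * x i) ^+ n <= \sum_i w i * x i ^+ n.
Proof.
case: n => // n _ w0 w1 x0; set a := \sum_i _.
have a0 : 0 <= a by apply: sumr_ge0 => i _; rewrite mulr_ge0.
have h : \sum_i w i * (a ^+ n.+1 + n.+1%:R * a ^+ n * (x i - a)) <=
         \sum_i w i * x i ^+ n.+1.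
  by apply: ler_sum => i _; rewrite ler_wpM2l // pow_tangent.
apply: le_trans h; under eq_bigr do rewrite mulrDr mulrCA mulrBr.
rewrite big_split /= -mulr_suml -mulr_sumr sumrB -mulr_suml -/a.
set W := \sum_i w i in w1 *.
rewrite -subr_ge0 [X in 0 <= X](_ : _ = n%:R * a ^+ n.+1 * (1 - W)).
  by rewrite mulr_ge0 ?subr_ge0 // mulr_ge0 // exprn_ge0.
rewrite -natr1 exprS; ring.
Qed.

(* By the duplication formula, from the case of small [y]. *)
Lemma cosh_le y : expR y + expR (- y) <= 2 * expR (2 * y ^+ 2).
Proof.
have small (z : R) : `|z| <= 2^-1 -> expR z + expR (- z) <= 2 * expR (2 * z ^+ 2).
  move=> hz.
  (* From [(1 - t) exp t <= 1]; the range [|t| <= 1/2] makes the constant 2 sufficient. *)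
  have e1 (t : R) : `|t| <= 2^-1 -> expR t <= 1 + t + 2 * t ^+ 2.
    rewrite ler_norml => /andP[t1 t2].
    have h : 1 - t <= (expR t)^-1 by rewrite -expRN; exact: expR_ge1Dx.
    have e0 := expR_gt0 t.
    have h2 : (1 - t) * expR t <= 1 by rewrite -ler_pdivlMr // div1r.
    have p : 0 < 1 - t by lra.
    rewrite -(ler_pM2l p); apply: (le_trans h2).
    have -> : (1 - t) * (1 + t + 2 * t ^+ 2) = 1 + t ^+ 2 * (1 - 2 * t) by ring.
    by rewrite lerDl mulr_ge0 ?sqr_ge0 //; lra.
  have h1 := e1 _ hz; have h2 := e1 (- z); rewrite normrN in h2.
  have {}h2 := h2 hz; rewrite sqrrN in h2.
  have h3 := expR_ge1Dx (2 * z ^+ 2); lra.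
have step (z : R) : expR z + expR (- z) <= 2 * expR (2 * z ^+ 2) ->
  expR (2 * z) + expR (- (2 * z)) <= 2 * expR (2 * (2 * z) ^+ 2).
  set c := expR z; set d := expR (- z); set E := expR (2 * z ^+ 2) => h.
  have cd : c * d = 1 by rewrite -expRD subrr expR0.
  have -> : expR (2 * z) = c ^+ 2 by rewrite -expRM_natl mulr_natl.
  have -> : expR (- (2 * z)) = d ^+ 2 by rewrite -expRM_natl mulrN.
  have -> : expR (2 * (2 * z) ^+ 2) = E ^+ 4.
    by rewrite -expRM_natl; congr expR; ring.
  have c0 : 0 < c by exact: expR_gt0.
  have d0 : 0 < d by exact: expR_gt0.
  have h2 : (c + d) ^+ 2 <= (2 * E) ^+ 2.
    by rewrite lerXn2r ?nnegrE ?mulr_ge0 ?addr_ge0 ?expR_ge0.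
  have -> : c ^+ 2 + d ^+ 2 = (c + d) ^+ 2 - 2 * (c * d) by ring.
  rewrite cd; apply: (@le_trans _ _ ((2 * E) ^+ 2 - 2 * 1)); first by lra.
  have := sqr_ge0 (E ^+ 2 - 1); nra.
have main n : forall z : R, `|z| <= 2^-1 * 2 ^+ n ->
  expR z + expR (- z) <= 2 * expR (2 * z ^+ 2).
  elim: n => [|n ih] z hz; first by apply: small; rewrite mulr1 in hz.
  have -> : z = 2 * (z / 2) by field.
  apply/step/ih; rewrite normrM normfV (ger0_norm (ltW (ltr0n R 2))).
  by rewrite ler_pdivrMr // -mulrA -exprSr.
apply: (main (Num.bound `|y|).+1).
rewrite exprS mulrA mulVf ?mul1r ?pnatr_eq0 //.
have /ltW := archi_boundP (normr_ge0 y) => /le_trans; apply.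
by rewrite -natrX ler_nat ltnW // ltn_expl.
Qed.

(** The chord of the exponential over [[-B, B]] lies above it; averaging a centered variable removes
    its slope and leaves [cosh B], bounded by [cosh_le]. *)
Lemma hoeffding_step (I : finType) (w xi : I -> R) (B : R) :
  (forall i, 0 <= w i) -> \sum_i w i = 1 -> 0 < B ->
  (forall i, `|xi i| <= B) -> \sum_i w i * xi i = 0 ->
  \sum_i w i * expR (xi i) <= expR (2 * B ^+ 2).
Proof.
move=> w0 w1 B0 xiB xi0.
have chord (x : R) : `|x| <= B ->
    2 * B * expR x <= (B + x) * expR B + (B - x) * expR (- B).
  rewrite ler_norml => /andP[x1 x2].
  have h1 := expR_ge1Dx (B - x); have h2 := expR_ge1Dx (- B - x).
  have e0 := expR_gt0 x.
  have E1 : expR B = expR x * expR (B - x) by rewrite -expRD; congr expR; ring.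
  have E2 : expR (- B) = expR x * expR (- B - x) by rewrite -expRD; congr expR; ring.
  rewrite E1 E2.
  have -> : (B + x) * (expR x * expR (B - x)) + (B - x) * (expR x * expR (- B - x))
    = expR x * ((B + x) * expR (B - x) + (B - x) * expR (- B - x)) by ring.
  rewrite mulrC; apply: ler_wpM2l; first exact: ltW.
  nra.
have B2 : 0 < 2 * B by rewrite mulr_gt0.
rewrite -(ler_pM2l B2) mulr_sumr.
apply: (@le_trans _ _ (\sum_i w i * ((B + xi i) * expR B + (B - xi i) * expR (- B)))).
  by apply: ler_sum => i _; rewrite mulrCA ler_wpM2l // chord.
under eq_bigr => i _.
  rewrite (_ : _ * _ = w i * (B * expR B + B * expR (- B)) +
     w i * xi i * (expR B - expR (- B))); last by ring.
  over.
rewrite big_split /= -!mulr_suml w1 xi0 mul1r mul0r addr0 -mulrDr.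
by rewrite [2 * B]mulrC -mulrA ler_pM2l // cosh_le.
Qed.

End Elementary.

(** * Moments of Rademacher sums and of their finite maxima *)

Section Rademacher.
Variable R : realType.

Definition rad_avg (I : finType) (f : {ffun I -> bool} -> R) : R :=
  \sum_e 2^-1 ^+ #|I| * f e.

Definition rad_sum (I : finType) (c : I -> R) (e : {ffun I -> bool}) : R :=
  \sum_i (-1) ^+ e i * c i.

Variable I : finType.
Implicit Types (f g : {ffun I -> bool} -> R) (c : I -> R).

Lemma half_exp_ge0 n : 0 <= (2^-1 : R) ^+ n.
Proof. by rewrite exprn_ge0 // invr_ge0. Qed.

Lemma rad_avg1 : \sum_(e : {ffun I -> bool}) (2^-1 : R) ^+ #|I| = 1.
Proof.
rewrite sumr_const card_ffun card_bool -[LHS]mulr_natr natrX -exprMn mulVf ?expr1n //.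
Qed.

Lemma le_rad_avg f g : (forall e, f e <= g e) -> rad_avg f <= rad_avg g.
Proof. by move=> h; apply: ler_sum => e _; rewrite ler_wpM2l ?half_exp_ge0. Qed.

Lemma rad_avg_ge0 f : (forall e, 0 <= f e) -> 0 <= rad_avg f.
Proof. by move=> h; apply: sumr_ge0 => e _; rewrite mulr_ge0 ?half_exp_ge0. Qed.

Lemma rad_avgZ a f : rad_avg (fun e => a * f e) = a * rad_avg f.
Proof. by rewrite /rad_avg mulr_sumr; apply: eq_bigr => e _; rewrite mulrCA. Qed.

Lemma rad_avg_sum (J : finType) (F : J -> {ffun I -> bool} -> R) (P : pred J) :
  rad_avg (fun e => \sum_(j | P j) F j e) = \sum_(j | P j) rad_avg (F j).
Proof.
by rewrite /rad_avg exchange_big /=; apply: eq_bigr => e _; rewrite mulr_sumr.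
Qed.

Lemma rad_jensen f n : (0 < n)%N -> (forall e, 0 <= f e) ->
  rad_avg f ^+ n <= rad_avg (fun e => f e ^+ n).
Proof.
move=> n0 f0; apply: pow_jensen => //; by rewrite rad_avg1.
Qed.

(** Independence of the signs turns the average of the exponential into a product of hyperbolic
    cosines. *)
Lemma rad_mgf c : rad_avg (fun e => expR (rad_sum c e)) <= expR (2 * \sum_i c i ^+ 2).
Proof.
rewrite /rad_avg (_ : \sum_e _ = \prod_i \sum_b 2^-1 * expR ((-1) ^+ (b : bool) * c i)).
  rewrite mulr_sumr expR_sum; apply: ler_prod => i _.
  rewrite big_bool /= expr1 expr0 mulN1r mul1r -mulrDr addrC.
  rewrite mulr_ge0 ?addr_ge0 ?expR_ge0 //= mulrC ler_pdivrMr // mulrC.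
  exact: cosh_le.
rewrite bigA_distr_bigA; apply: eq_bigr => e _.
by rewrite big_split /= prodr_const expR_sum.
Qed.

Definition khintchine_cst : R := 8 * expR 2.

Lemma khintchine_cst_gt0 : 0 < khintchine_cst.
Proof. by rewrite mulr_gt0 // expR_gt0. Qed.

(** Even powers are dominated by [exp y + exp (- y)], whose average [rad_mgf] bounds once the sum is
    scaled by [th]. *)
Lemma khintchine c (q : nat) (v : R) : (0 < q)%N -> \sum_i c i ^+ 2 <= v ->
  rad_avg (fun e => rad_sum c e ^+ (2 * q)) <= (khintchine_cst * q%:R * v) ^+ q.
Proof.
move=> q0 hv.
have v0 : 0 <= v by apply: le_trans hv; apply: sumr_ge0 => i _; exact: sqr_ge0.
have [vgt0|] := ltrP 0 v; last first.
  move=> vle; have c0 i : c i = 0.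
    have /eqP : \sum_i c i ^+ 2 = 0.
      apply/eqP; rewrite eq_le (le_trans hv vle) /=.
      by apply: sumr_ge0 => j _; exact: sqr_ge0.
    rewrite psumr_eq0 => [/allP/(_ i)|j _]; last exact: sqr_ge0.
    by rewrite mem_index_enum sqrf_eq0 => /(_ isT) /eqP.
  rewrite /rad_avg big1 ?exprn_ge0 ?mulr_ge0 // ?ltW ?khintchine_cst_gt0 //.
  move=> e _; rewrite /rad_sum big1 ?expr0n ?muln_eq0 /= -?lt0n.
    by rewrite (gtn_eqF q0) mulr0.
  by move=> i _; rewrite c0 mulr0.
have qR : 0 < q%:R :> R by rewrite ltr0n.
(* This scaling makes [th^2 \sum c_i^2 <= q], so the exponential moments are at most [exp (2 q)]. *)
set th := Num.sqrt (q%:R / v).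
have th2 : th ^+ 2 = q%:R / v by rewrite sqr_sqrtr // divr_ge0 // ltW.
(* For [z >= 0], raise [z / (2 q) <= exp (z / (2 q))] to the power [2 q]. *)
have pt (y : R) : y ^+ (2 * q) <= (2 * q%:R) ^+ (2 * q) * (expR y + expR (- y)).
  have h (z : R) : 0 <= z -> z ^+ (2 * q) <= (2 * q%:R) ^+ (2 * q) * expR z.
    move=> z0; have Q0 : 0 < 2 * q%:R :> R by rewrite mulr_gt0.
    have -> : expR z = expR (z / (2 * q%:R)) ^+ (2 * q).
      by rewrite -expRM_natr natrM divfK // gt_eqF.
    rewrite -exprMn lerXn2r ?nnegrE // ?mulr_ge0 ?expR_ge0 ?(ltW Q0) //.
    rewrite mulrC -ler_pdivrMr //.
    by have := expR_ge1Dx (z / (2 * q%:R)); lra.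
  have Q1 : 0 <= (2 * q%:R : R) ^+ (2 * q) by rewrite exprn_ge0 // mulr_ge0.
  have [y0|y0] := leP 0 y.
    by apply: (le_trans (h _ y0)); rewrite ler_wpM2l // lerDl expR_ge0.
  have -> : y ^+ (2 * q) = (- y) ^+ (2 * q) by rewrite !exprM sqrrN.
  apply: (@le_trans _ _ ((2 * q%:R) ^+ (2 * q) * expR (- y))).
    by apply: h; rewrite oppr_ge0 ltW.
  by rewrite ler_wpM2l // lerDr expR_ge0.
have rs a e : a * rad_sum c e = rad_sum (fun i => a * c i) e.
  by rewrite /rad_sum mulr_sumr; apply: eq_bigr => i _; rewrite mulrCA.
have mg (a : R) : a ^+ 2 = th ^+ 2 ->
    rad_avg (fun e => expR (a * rad_sum c e)) <= expR (2 * q%:R).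
  move=> a2; under [X in rad_avg X]eq_fun do rewrite rs.
  apply: (le_trans (rad_mgf _)); rewrite ler_expR ler_pM2l //.
  under eq_bigr do rewrite exprMn a2 th2.
  by rewrite -mulr_sumr -mulrA ler_piMr ?(ltW qR) // mulrC ler_pdivrMr // mul1r.
have key : th ^+ (2 * q) * rad_avg (fun e => rad_sum c e ^+ (2 * q)) <=
    (2 * q%:R) ^+ (2 * q) * (2 * expR (2 * q%:R)).
  rewrite -rad_avgZ.
  apply: (@le_trans _ _ (rad_avg (fun e => (2 * q%:R) ^+ (2 * q) *
     (expR (th * rad_sum c e) + expR ((- th) * rad_sum c e))))).
    by apply: le_rad_avg => e; rewrite -exprMn mulNr pt.
  rewrite rad_avgZ ler_wpM2l ?exprn_ge0 ?mulr_ge0 //.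
  rewrite /rad_avg; under eq_bigr do rewrite mulrDr.
  rewrite big_split /= mulr_natl mulr2n lerD //; apply: mg => //.
  by rewrite sqrrN.
have : (q%:R / v) ^+ q * rad_avg (fun e => rad_sum c e ^+ (2 * q)) <=
    (q%:R / v) ^+ q * (khintchine_cst * q%:R * v) ^+ q.
  rewrite -[in X in X <= _]th2 -exprM; apply: (le_trans key).
  rewrite -exprMn (_ : q%:R / v * _ = 2 * ((2 * q%:R) ^+ 2 * expR 2)); last first.
    by rewrite /khintchine_cst; field; rewrite gt_eqF.
  rewrite [leRHS]exprMn [X in _ <= _ * X]exprMn -exprM mulrCA.
  rewrite [expR (2 * q%:R)]expRM_natr.
  by rewrite ler_wpM2r ?mulr_ge0 ?exprn_ge0 ?expR_ge0 ?mulr_ge0 // -[leLHS]expr1 ler_eXn2l ?ltr1n.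
by rewrite ler_pM2l // exprn_gt0 // divr_gt0.
Qed.

(* Passing to the moment of order [2 r q] first makes the union bound over [A]
   cost only a factor [#|A| ^ (1 / (r q)) <= e]. *)
Lemma rad_max_moment (J : finType) (A : {set J}) (c : J -> I -> R)
    (g : {ffun I -> bool} -> R) (q r : nat) (v : R) :
  (0 < q)%N -> (0 < r)%N -> 0 <= v ->
  (forall x, x \in A -> \sum_i c x i ^+ 2 <= v) ->
  ln (#|A|%:R : R) <= (r * q)%:R ->
  (forall e, 0 <= g e) ->
  (forall e, exists2 x, x \in A & g e <= `|rad_sum (c x) e|) ->
  rad_avg (fun e => g e ^+ (2 * q)) <=
    (khintchine_cst * expR 1 * (r * q)%:R * v) ^+ q.
Proof.
move=> q0 r0 v0 hv hA g0 hg.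
set K := khintchine_cst; have K0 : 0 < K := khintchine_cst_gt0.
have G0 e : 0 <= g e ^+ (2 * q) by rewrite exprn_ge0.
have B0 : 0 <= (K * expR 1 * (r * q)%:R * v) ^+ q.
  by rewrite exprn_ge0 // !mulr_ge0 ?expR_ge0 // ltW.
rewrite -(ler_pXn2r r0) ?nnegrE //; last exact: rad_avg_ge0.
apply: (le_trans (rad_jensen r0 G0)).
apply: (@le_trans _ _ (rad_avg (fun e =>
    \sum_(x in A) rad_sum (c x) e ^+ (2 * (r * q))))).
  apply: le_rad_avg => e; have [x xA gx] := hg e.
  rewrite (bigD1 x) //= -exprM -mulnA [(q * r)%N]mulnC.
  apply: (@le_trans _ _ (rad_sum (c x) e ^+ (2 * (r * q)))); last first.
    by rewrite lerDl sumr_ge0 // => y _; rewrite exprM exprn_ge0 // sqr_ge0.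
  rewrite [leRHS]exprM -real_normK ?num_real // -exprM.
  by rewrite lerXn2r ?nnegrE.
rewrite rad_avg_sum.
apply: (@le_trans _ _ (\sum_(x in A) (K * (r * q)%:R * v) ^+ (r * q))).
  by apply: ler_sum => x xA; apply: khintchine; rewrite ?muln_gt0 ?q0 ?r0 // hv.
rewrite sumr_const -exprM [(q * r)%N]mulnC.
rewrite (_ : K * expR 1 * _ * v = expR 1 * (K * (r * q)%:R * v)); last by ring.
rewrite [leRHS]exprMn -expRM_natr mul1r -[leLHS]mulr_natl.
apply: ler_wpM2r; first by rewrite exprn_ge0 // !mulr_ge0 // ltW.
have [A0|] := posnP #|A|; first by rewrite A0 expR_ge0.
by move=> A0; rewrite -[leLHS]lnK ?posrE ?ltr0n // ler_expR.
Qed.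

End Rademacher.

(** * Chaining in moments of order [2 q] *)

Section Chaining.
Variables (R : realType) (I T : finType).

(** The sum telescopes along the chain [pi], so the supremum is at most the sum of the maxima [g l]
    over the links. Jensen's inequality with the weights [w] passes the power [2 q] inside, where
    each level has to fit in [w l ^ 2 * B]. *)
Lemma chaining (c : T -> I -> R) (L q : nat) (pi : nat -> T -> T)
    (w v : nat -> R) (r : nat -> nat) (B : R) :
  (0 < q)%N -> 0 <= B -> (0 < #|T|)%N ->
  (forall x, pi L x = x) -> (forall x i, c (pi 0%N x) i = 0) ->
  (forall l x, (l < L)%N ->
     \sum_i (c (pi l.+1 x) i - c (pi l x) i) ^+ 2 <= v l) ->
  (forall l, (l < L)%N -> (0 < r l)%N /\
     ln (#|[set (pi l x, pi l.+1 x) | x in [set: T]]|%:R : R) <= (r l * q)%:R) ->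
  (forall l, 0 < w l) -> \sum_(l < L) w l <= 1 ->
  (forall l, (l < L)%N ->
     khintchine_cst R * expR 1 * (r l * q)%:R * v l <= w l ^+ 2 * B) ->
  rad_avg (fun e => (\big[Num.max/0]_x `|rad_sum (c x) e|) ^+ (2 * q)) <= B ^+ q.
Proof.
move=> q0 B0 /card_gt0P[x0 _] piL pi0 hv hr w0 w1 hB.
pose dc (z : T * T) i : R := c z.2 i - c z.1 i.
pose g l e : R := \big[Num.max/0]_x `|rad_sum (dc (pi l x, pi l.+1 x)) e|.
have g0 l e : 0 <= g l e by apply: bigmax_ge_id.
have G0 e : 0 <= \big[Num.max/0]_x `|rad_sum (c x) e| by apply: bigmax_ge_id.
have tele n x e : rad_sum (c (pi n x)) e = \sum_(l < n) rad_sum (dc (pi l x, pi l.+1 x)) e.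
  elim: n => [|n ih].
    by rewrite big_ord0 /rad_sum big1 // => i _; rewrite pi0 mulr0.
  rewrite big_ord_recr /= -ih /rad_sum -big_split /=; apply: eq_bigr => i _.
  by rewrite -mulrDr addrC subrK.
have Gg e : \big[Num.max/0]_x `|rad_sum (c x) e| <= \sum_(l < L) g l e.
  apply/bigmax_leP; split=> [|x _]; first by apply: sumr_ge0 => l _; exact: g0.
  rewrite -{1}(piL x) tele; apply: (le_trans (ler_norm_sum _ _ _)).
  apply: ler_sum => l _.
  exact: (le_bigmax 0 (fun x => `|rad_sum (dc (pi l x, pi l.+1 x)) e|) x).
apply: (@le_trans _ _
  (rad_avg (fun e => \sum_(l < L) w l * (g l e / w l) ^+ (2 * q)))).
  apply: le_rad_avg => e.
  apply: (@le_trans _ _ ((\sum_(l < L) w l * (g l e / w l)) ^+ (2 * q))).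
    rewrite lerXn2r ?nnegrE //.
      by apply: sumr_ge0 => l _; rewrite mulr_ge0 ?divr_ge0 // ltW.
    apply: (le_trans (Gg e)); apply: ler_sum => l _.
    by rewrite mulrC divfK // gt_eqF.
  apply: pow_jensen => // [|l|l]; first by rewrite muln_gt0.
    exact: ltW.
  by rewrite divr_ge0 // ltW.
rewrite (rad_avg_sum _ predT).
apply: (@le_trans _ _ (\sum_(l < L) w l * B ^+ q)); last first.
  by rewrite -mulr_suml ler_piMl // exprn_ge0.
apply: ler_sum => l _; rewrite rad_avgZ ler_wpM2l ?(ltW (w0 l)) //.
have [rl hl] := hr l (ltn_ord l).
have v0 : 0 <= v l by apply: le_trans (hv l x0 (ltn_ord l)); apply: sumr_ge0 => i _; exact: sqr_ge0.
have := @rad_max_moment R I _ [set (pi l x, pi l.+1 x) | x in [set: T]] dc (g l) q (r l) (v l)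
  q0 rl v0 _ hl (g0 l) _.
have h1 : forall z, z \in [set (pi l x, pi l.+1 x) | x in [set: T]] ->
  \sum_i dc z i ^+ 2 <= v l.
  by move=> z /imsetP[x _ ->]; apply: hv.
have h2 e : exists2 z, z \in [set (pi l x, pi l.+1 x) | x in [set: T]] &
    g l e <= `|rad_sum (dc z) e|.
  have [||y _ hy] := @eq_bigmax _ R T 0 x0 predT (fun x => `|rad_sum (dc (pi l x, pi l.+1 x)) e|) => //.
  exists (pi l y, pi l.+1 y); last by rewrite /g hy.
  by apply/imsetP; exists y; rewrite ?inE.
move=> /(_ h1 h2) h3.
under [X in rad_avg X]eq_fun do rewrite exprMn mulrC.
rewrite rad_avgZ exprVn mulrC ler_pdivrMr ?exprn_gt0 //.
apply: (le_trans h3); rewrite exprM -exprMn; apply: lerXn2r.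
- by rewrite nnegrE !mulr_ge0 ?expR_ge0 // ltW // khintchine_cst_gt0.
- by rewrite nnegrE mulr_ge0 ?sqr_ge0.
- by rewrite [leRHS]mulrC hB.
Qed.

End Chaining.

(** * Quadratic forms on sparse vectors *)

Section SparseNorm.
Variables (R : realType) (k : nat).
Implicit Types (Q : 'M[R]_k) (x y z : 'cV[R]_k) (b : 'rV[R]_k).

Definition qform Q x : R := (x^T *m Q *m x) 0 0.

Lemma qformD Q1 Q2 x : qform (Q1 + Q2) x = qform Q1 x + qform Q2 x.
Proof. by rewrite /qform mulmxDr mulmxDl mxE. Qed.

Lemma qformZ a Q x : qform (a *: Q) x = a * qform Q x.
Proof. by rewrite /qform -scalemxAr -scalemxAl mxE. Qed.

Lemma qformB Q1 Q2 x : qform (Q1 - Q2) x = qform Q1 x - qform Q2 x.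
Proof. by rewrite qformD -scaleN1r qformZ mulN1r. Qed.

Lemma qform_sum (J : finType) (P : pred J) (F : J -> 'M[R]_k) x :
  qform (\sum_(j | P j) F j) x = \sum_(j | P j) qform (F j) x.
Proof. by rewrite /qform mulmx_sumr mulmx_suml summxE. Qed.

Lemma qform_scale Q a x : qform Q (a *: x) = a ^+ 2 * qform Q x.
Proof. by rewrite /qform -scalemxAr [(a *: x)^T]linearZ /= -!scalemxAl scalerA mxE expr2. Qed.

Lemma qform_outer b x : qform (b^T *m b) x = ((b *m x) 0 0) ^+ 2.
Proof.
rewrite /qform mulmxA -mulmxA -trmx_mul mxE big_ord1 expr2 mxE.
by [].
Qed.

Lemma qform1 x : qform 1%:M x = l2norm x ^+ 2.
Proof. by rewrite /qform mulmx1 l2norm_sqr mxE; apply: eq_bigr => i _; rewrite mxE expr2. Qed.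

Lemma l2normZ a x : l2norm (a *: x) ^+ 2 = a ^+ 2 * l2norm x ^+ 2.
Proof. by rewrite -!qform1 qform_scale. Qed.

Lemma l2norm_parallelogram x y :
  l2norm (x + y) ^+ 2 + l2norm (x - y) ^+ 2 = 2 * (l2norm x ^+ 2 + l2norm y ^+ 2).
Proof.
rewrite !l2norm_sqr -!big_split mulr_sumr; apply: eq_bigr => i _ /=.
by rewrite !mxE; ring.
Qed.

Lemma le_norm_l2norm x i : l2norm x ^+ 2 <= 1 -> `|x i 0| <= 1.
Proof.
move=> h; rewrite -(@ler_pXn2r _ 2) ?nnegrE // expr1n real_normK ?num_real //.
apply: le_trans h; rewrite l2norm_sqr (bigD1 i) //= lerDl.
by apply: sumr_ge0 => j _; exact: sqr_ge0.
Qed.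

Variable s : nat.

(** The unit ball rather than the sphere: it contains 0, so suprema over it are never over the empty
    set. *)
Definition sparse_ball : set 'cV[R]_k :=
  [set x | sparse s x /\ l2norm x ^+ 2 <= 1]%classic.

Lemma sparse_ball0 : sparse_ball 0.
Proof.
split; last by rewrite l2norm_sqr big1 // => i _; rewrite mxE expr0n.
by rewrite /sparse eq_card0 // => i; rewrite inE mxE eqxx.
Qed.

Definition sparse_norm Q : R := sup [set `|qform Q x| | x in sparse_ball]%classic.

Lemma sparse_norm_has_sup Q : has_sup [set `|qform Q x| | x in sparse_ball]%classic.
Proof.
split; first by exists `|qform Q 0|, 0 => //; exact: sparse_ball0.
exists (\sum_i \sum_j `|Q i j|) => _ [x [_ x1] <-].
rewrite /qform mxE; under eq_bigr do rewrite mxE mulr_suml.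
rewrite exchange_big /=; apply: (le_trans (ler_norm_sum _ _ _)).
apply: ler_sum => i _; apply: (le_trans (ler_norm_sum _ _ _)).
apply: ler_sum => j _; rewrite mxE !normrM mulrAC.
rewrite ler_piMl // -[1]mulr1; apply: ler_pM => //; exact: le_norm_l2norm.
Qed.

Lemma le_sparse_norm Q x : sparse_ball x -> `|qform Q x| <= sparse_norm Q.
Proof. by move=> Dx; apply: sup_upper_bound; [exact: sparse_norm_has_sup|exists x]. Qed.

Lemma sparse_norm_le Q a : (forall x, sparse_ball x -> `|qform Q x| <= a) ->
  sparse_norm Q <= a.
Proof.
move=> h; apply: ge_sup; first by have [] := sparse_norm_has_sup Q.
by move=> _ [x Dx <-]; exact: h.
Qed.

Lemma sparse_norm_ge0 Q : 0 <= sparse_norm Q.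
Proof. exact: le_trans (le_sparse_norm Q sparse_ball0). Qed.

Lemma le_sparse_norm_scale Q x : sparse s x ->
  `|qform Q x| <= sparse_norm Q * l2norm x ^+ 2.
Proof.
move=> sx; have n0 : 0 <= l2norm x by exact: sqrtr_ge0.
have [x0|xn0] := eqVneq (l2norm x) 0.
  have -> : x = 0.
    apply/colP => i; rewrite mxE.
    have /eqP : l2norm x ^+ 2 = 0 by rewrite x0 expr0n.
    rewrite l2norm_sqr psumr_eq0 => [/allP/(_ i)|j _]; last exact: sqr_ge0.
    by rewrite mem_index_enum sqrf_eq0 => /(_ isT) /eqP.
  by rewrite -[X in qform _ X](scale0r 0) qform_scale expr0n mul0r normr0 mulr_ge0
    ?sparse_norm_ge0 ?sqr_ge0.
have p : 0 < l2norm x ^+ 2 by rewrite exprn_gt0 // lt_def xn0.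
rewrite -ler_pdivrMr //.
have -> : `|qform Q x| / l2norm x ^+ 2 = `|qform Q ((l2norm x)^-1 *: x)|.
  by rewrite qform_scale normrM exprVn [`|_^-1|]ger0_norm ?invr_ge0 ?(ltW p) // mulrC.
apply: le_sparse_norm; split.
  rewrite /sparse in sx *; apply: leq_trans sx; apply/subset_leq_card/fintype.subsetP => i.
  by rewrite !inE mxE mulf_eq0 negb_or => /andP[].
by rewrite l2normZ exprVn mulVf // gt_eqF.
Qed.

Lemma sparse_normD Q1 Q2 : sparse_norm (Q1 + Q2) <= sparse_norm Q1 + sparse_norm Q2.
Proof.
apply: sparse_norm_le => x Dx; rewrite qformD; apply: (le_trans (ler_normD _ _)).
by rewrite lerD // le_sparse_norm.
Qed.

Lemma sparse_normN Q : sparse_norm (- Q) = sparse_norm Q.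
Proof.
suff h Q' : sparse_norm (- Q') <= sparse_norm Q'.
  by apply/eqP; rewrite eq_le h /= -{1}[Q]opprK h.
apply: sparse_norm_le => x Dx; rewrite -scaleN1r qformZ mulN1r normrN.
exact: le_sparse_norm.
Qed.

Lemma sparse_norm1 : sparse_norm 1%:M <= 1.
Proof. by apply: sparse_norm_le => x [_ h]; rewrite qform1 ger0_norm ?sqr_ge0. Qed.

(** Polarization of [(x - y)^T Q (x + y)]. The factors 4 and [4^-1] balance the two arguments in
    [sparse_norm_net]: the lengths [1/8] and 2 both become [1/2]. *)
Lemma qform_polar Q x y : Q^T = Q ->
  qform Q x - qform Q y = 4^-1 * (qform Q (4 *: (x - y) + 4^-1 *: (x + y)) -
     qform Q (4 *: (x - y) - 4^-1 *: (x + y))).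
Proof.
move=> sQ; pose B (u v : 'cV[R]_k) : R := (u^T *m Q *m v) 0 0.
have Bsym u v : B u v = B v u.
  rewrite /B -[in LHS](trmxK (u^T *m Q *m v)) mxE !trmx_mul trmxK sQ mulmxA.
  by [].
have BD u v z : B (u + v) z = B u z + B v z.
  by rewrite /B linearD /= !mulmxDl mxE.
have BZ a u z : B (a *: u) z = a * B u z.
  by rewrite /B linearZ /= -!scalemxAl mxE.
have BDr u v z : B z (u + v) = B z u + B z v by rewrite Bsym BD (Bsym u z) (Bsym v z).
have BZr a u z : B z (a *: u) = a * B z u by rewrite Bsym BZ (Bsym u z).
have BN u z : B (- u) z = - B u z by rewrite -scaleN1r BZ mulN1r.
have BNr u z : B z (- u) = - B z u by rewrite Bsym BN (Bsym u z).
rewrite -![qform _ _]/(B _ _) !(BD, BDr, BN, BNr, BZ, BZr) (Bsym y x).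
by field.
Qed.

(* A net of radius 1/8 along the coordinate subspaces determines the norm up
   to a factor 2: [x^T Q x - y^T Q y = (x - y)^T Q (x + y)]. *)
Lemma sparse_norm_net Q (T : finType) (pt : T -> 'cV[R]_k) a : Q^T = Q ->
  (forall x, sparse_ball x -> exists t,
     (forall i, x i 0 = 0 -> pt t i 0 = 0) /\
     l2norm (pt t) ^+ 2 <= 1 /\ l2norm (x - pt t) ^+ 2 <= 64^-1) ->
  (forall t, sparse_ball (pt t) -> `|qform Q (pt t)| <= a) ->
  sparse_norm Q <= 2 * a.
Proof.
move=> sQ net ha.
(* The supremum is finite, so half of it can be absorbed in the left side. *)
suff : sparse_norm Q <= a + sparse_norm Q / 2 by lra.
apply: sparse_norm_le => x Dx; have [t [suppt [nt nxt]]] := net x Dx.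
have [sx nx] := Dx; set y := pt t in suppt nt nxt.
(* Sharing the support of [x] keeps all combinations of [x] and its net point [s]-sparse. *)
have sp (z : 'cV[R]_k) : (forall i, x i 0 = 0 -> z i 0 = 0) -> sparse s z.
  move=> hz; apply: leq_trans sx; apply/subset_leq_card/fintype.subsetP => i.
  by rewrite !inE; apply: contra => /eqP /hz ->.
have hy : `|qform Q y| <= a by apply: ha; split=> //; exact: sp.
have -> : qform Q x = qform Q y + (qform Q x - qform Q y) by rewrite addrC subrK.
apply: (le_trans (ler_normD _ _)); apply: lerD => //.
rewrite qform_polar //; set u := 4 *: _; set v := 4^-1 *: _.
have h1 : `|qform Q (u + v)| <= sparse_norm Q * l2norm (u + v) ^+ 2.
  apply: le_sparse_norm_scale; apply: sp => i xi.
  by rewrite !mxE (suppt i xi) xi; ring.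
have h2 : `|qform Q (u - v)| <= sparse_norm Q * l2norm (u - v) ^+ 2.
  apply: le_sparse_norm_scale; apply: sp => i xi.
  by rewrite !mxE (suppt i xi) xi; ring.
rewrite normrM ger0_norm ?invr_ge0 //.
have h3 := ler_normB (qform Q (u + v)) (qform Q (u - v)).
have h4 := l2norm_parallelogram u v.
have hu : l2norm u ^+ 2 <= 4^-1 by rewrite l2normZ; lra.
have hv : l2norm v ^+ 2 <= 4^-1.
  rewrite l2normZ.
  have := l2norm_parallelogram x y; have := sqr_ge0 (l2norm (x - y)); lra.
have n0 := sparse_norm_ge0 Q.
have h5 : sparse_norm Q * (l2norm (u + v) ^+ 2 + l2norm (u - v) ^+ 2) <= sparse_norm Q * 1.
  by rewrite ler_wpM2l // h4; lra.
lra.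
Qed.

End SparseNorm.

(** * Maurey's empirical method *)

Section Maurey.
Variables (R : realType) (k : nat).
Implicit Types (x : 'cV[R]_k).

Lemma exists_le_avg (I : finType) (w f : I -> R) : (forall i, 0 <= w i) ->
  \sum_i w i = 1 -> exists i, f i <= \sum_i w i * f i.
Proof.
move=> w0 w1; set S := \sum_i _ * _; apply: contrapT => /forallNP h.
have : 0 < \sum_i w i * (f i - S).
  have [i wi] : exists i, 0 < w i.
    apply: contrapT => /forallNP h2; have : \sum_i w i = 0.
      apply: big1 => i _; apply/eqP; rewrite eq_le w0 andbT leNgt.
      by apply/negP/h2.
    by rewrite w1 => /eqP; rewrite oner_eq0.
  have p j : 0 < f j - S by rewrite subr_gt0 ltNge; apply/negP/h.
  rewrite (bigD1 i) //= ltr_pwDl ?mulr_gt0 //.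
  by apply: sumr_ge0 => j _; rewrite mulr_ge0 // ltW.
under eq_bigr do rewrite mulrBr.
by rewrite sumrB -mulr_suml w1 mul1r subrr ltxx.
Qed.

(** The vertices of the l1-ball of radius [tau]; the boolean is the sign, [true] for minus. *)
Definition atom (tau : R) (jb : 'I_k * bool) : 'cV[R]_k :=
  ((-1) ^+ jb.2 * tau) *: delta_mx jb.1 0.

Lemma mul_atom tau jb (b : 'rV[R]_k) :
  (b *m atom tau jb) 0 0 = (-1) ^+ jb.2 * tau * b 0 jb.1.
Proof.
by rewrite -scalemxAr mxE -colE mxE.
Qed.

(** [x] is the mean of a random atom, so by Hoeffding's lemma the potential grows on average by at
    most the stated factor, and some atom does no worse than the average. *)
Lemma maurey_step (J : finType) (b : J -> 'rV[R]_k) (K tau th : R)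
    (c : J -> R) x :
  (forall j i, `|b j 0 i| <= K) -> 0 < K -> 0 < tau -> 0 < th -> (0 < k)%N ->
  (forall j, 0 <= c j) -> \sum_i `|x i 0| <= tau ->
  exists jb, \sum_j c j * expR (th * (b j *m (atom tau jb - x)) 0 0) <=
    expR (8 * (th * K * tau) ^+ 2) * \sum_j c j.
Proof.
move=> bK K0 tau0 th0 k0 c0 xtau.
pose S : R := \sum_i `|x i 0| / tau.
(* The mass that [x] lacks to reach l1-norm [tau] is spread evenly; split equally between the two
   signs, it does not move the mean. *)
pose E (i : 'I_k) : R := `|x i 0| / tau + (1 - S) / k%:R.
pose w (jb : 'I_k * bool) : R := (E jb.1 + (-1) ^+ jb.2 * (x jb.1 0 / tau)) / 2.
have S1 : S <= 1 by rewrite /S -mulr_suml ler_pdivrMr // mul1r.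
have kR : 0 < k%:R :> R by rewrite ltr0n.
have w0 jb : 0 <= w jb.
  rewrite /w divr_ge0 // /E addrAC addr_ge0 //; last by rewrite divr_ge0 ?subr_ge0 // ltW.
  have h : `|(-1) ^+ jb.2 * (x jb.1 0 / tau)| = `|x jb.1 0| / tau.
    by rewrite normrM normr_sign mul1r normrM normfV (gtr0_norm tau0).
  by rewrite -h; have := ler_norm (- ((-1) ^+ jb.2 * (x jb.1 0 / tau))); rewrite normrN; lra.
have wsum i : w (i, true) + w (i, false) = E i by rewrite /w /= expr0 expr1; field; rewrite gt_eqF.
have pairsum (F : 'I_k * bool -> R) : \sum_jb F jb = \sum_i (F (i, true) + F (i, false)).
  rewrite (eq_bigr (fun p => F (p.1, p.2))) => [|[i bt] _] //.
  rewrite -(pair_bigA _ (fun (i : 'I_k) (b : bool) => F (i, b))) /=.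
  by apply: eq_bigr => i _; rewrite big_bool.
have w1 : \sum_jb w jb = 1.
  rewrite pairsum; under eq_bigr do rewrite wsum.
  rewrite big_split /= sumr_const card_ord -/S -[X in S + X]mulr_natr.
  by field; rewrite gt_eqF.
have [jb h] := exists_le_avg (fun jb =>
  \sum_j c j * expR (th * (b j *m (atom tau jb - x)) 0 0)) w0 w1.
exists jb; apply: (le_trans h).
under eq_bigr do rewrite mulr_sumr.
rewrite exchange_big /= mulr_sumr; apply: ler_sum => j _.
under eq_bigr do rewrite mulrCA.
rewrite -mulr_sumr mulrC ler_wpM2r //.
have bx : (b j *m x) 0 0 = \sum_i b j 0 i * x i 0 by rewrite mxE.
have B0 : 0 < 2 * (th * K * tau) by rewrite !mulr_gt0.
have -> : 8 * (th * K * tau) ^+ 2 = 2 * (2 * (th * K * tau)) ^+ 2 by ring.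
apply: hoeffding_step => // [i|].
- rewrite mulmxBr mxE [X in _ + X]mxE mul_atom normrM (gtr0_norm th0).
  have h1 : `|(-1) ^+ i.2 * tau * b j 0 i.1| <= K * tau.
    by rewrite !normrM normr_sign mul1r (gtr0_norm tau0) mulrC ler_wpM2r // ltW.
  have h2 : `|(b j *m x) 0 0| <= K * tau.
    rewrite bx; apply: (le_trans (ler_norm_sum _ _ _)).
    apply: (@le_trans _ _ (\sum_i K * `|x i 0|)).
      by apply: ler_sum => l _; rewrite normrM ler_wpM2r.
    by rewrite -mulr_sumr ler_wpM2l // ltW.
  rewrite (_ : 2 * (th * K * tau) = th * (K * tau + K * tau)); last by ring.
  rewrite ler_wpM2l ?(ltW th0) //; apply: (le_trans (ler_normB _ _)).
  exact: lerD.
- have hj i : (b j *m (atom tau i - x)) 0 0 =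
      (-1) ^+ i.2 * tau * b j 0 i.1 - (b j *m x) 0 0.
    by rewrite mulmxBr mxE [X in _ + X]mxE mul_atom.
  under eq_bigr do rewrite hj mulrCA mulrBr.
  rewrite -mulr_sumr sumrB -mulr_suml w1 mul1r bx pairsum -sumrB.
  rewrite big1 ?mulr0 // => i _.
  by rewrite /w /= expr0 expr1; field; rewrite gt_eqF.
Qed.

(* Maurey's sampling, derandomized: the atoms are chosen one after the other so
   that an exponential potential does not grow more than on average. *)
Lemma maurey_potential (J : finType) (b : J -> 'rV[R]_k) (K tau th : R) x r :
  (forall j i, `|b j 0 i| <= K) -> 0 < K -> 0 < tau -> 0 < th -> (0 < k)%N ->
  \sum_i `|x i 0| <= tau ->
  exists v : r.-tuple ('I_k * bool),
    \sum_j expR (th * \sum_(jb <- v) (b j *m (atom tau jb - x)) 0 0) <=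
    expR (8 * (th * K * tau) ^+ 2) ^+ r * #|J|%:R.
Proof.
move=> bK K0 tau0 th0 k0 xtau; elim: r => [|r [v hv]].
  exists [tuple]; rewrite expr0 mul1r.
  by under eq_bigr do rewrite big_nil mulr0 expR0; rewrite sumr_const.
have [jb h] := @maurey_step J b K tau th
  (fun j => expR (th * \sum_(jb <- v) (b j *m (atom tau jb - x)) 0 0)) x
  bK K0 tau0 th0 k0 (fun j => expR_ge0 _) xtau.
exists [tuple of jb :: v].
rewrite exprS -mulrA; apply: le_trans (ler_wpM2l (expR_ge0 _) hv).
apply: le_trans h; rewrite le_eqVlt; apply/orP; left; apply/eqP.
by apply: eq_bigr => j _; rewrite /= big_cons mulrDr expRD mulrC.
Qed.

Definition maurey_point (tau : R) r (v : r.-tuple ('I_k * bool)) : 'cV[R]_k :=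
  r%:R^-1 *: \sum_(jb <- v) atom tau jb.

(** Each term of the potential is at most the whole sum, so the logarithm of the bound on the
    potential controls every row at once. *)
Lemma maurey (J : finType) (b : J -> 'rV[R]_k) (K tau d : R) x r :
  (forall j i, `|b j 0 i| <= K) -> 0 < K -> 0 < tau -> 0 < d -> (0 < k)%N ->
  \sum_i `|x i 0| <= tau -> (0 < r)%N ->
  32 * K ^+ 2 * tau ^+ 2 * ln ((2 * #|J|)%:R : R) <= r%:R * d ^+ 2 ->
  exists v : r.-tuple ('I_k * bool),
    forall j, `|(b j *m (x - maurey_point tau v)) 0 0| <= d.
Proof.
move=> bK K0 tau0 d0 k0 xtau r0 hr.
have rR : 0 < r%:R :> R by rewrite ltr0n.
have KT : 0 < K ^+ 2 * tau ^+ 2 by rewrite mulr_gt0 // exprn_gt0.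
(* Minimizes [8 (th K tau)^2 - th d]: the quadratic cost is then exactly [th d / 2] per atom, and
   the other half pays for [ln (2 #|J|)]. *)
set th := d / (16 * (K ^+ 2 * tau ^+ 2)).
have th0 : 0 < th by rewrite divr_gt0 // mulr_gt0.
(* Both signs of each row, so that the potential sees absolute values. *)
pose bb (jb : J * bool) := (-1) ^+ jb.2 *: b jb.1.
have bbK jb i : `|bb jb 0 i| <= K by rewrite mxE normrM normr_sign mul1r.
have [v hv] := maurey_potential r bbK K0 tau0 th0 k0 xtau; rewrite /bb in hv.
exists v => j.
set D := (b j *m _) 0 0.
have rD : \sum_(jb <- v) (b j *m (atom tau jb - x)) 0 0 = - (r%:R * D).
  under eq_bigr do rewrite mulmxBr mxE [X in _ + X]mxE.
  rewrite sumrB big_const_seq count_predT size_tuple iter_addr_0 -summxE -mulmx_sumr.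
  have -> : D = (b j *m x) 0 0 - r%:R^-1 * (b j *m \sum_(jb <- v) atom tau jb) 0 0.
    by rewrite /D mulmxBr mxE [X in _ + X]mxE -scalemxAr [X in _ - X]mxE.
  rewrite mulrBr mulVKf ?gt_eqF //.
  by rewrite -[_ *+ r]mulr_natl; ring.
have e1 : expR (th * (r%:R * `|D|)) <= expR (8 * (th * K * tau) ^+ 2) ^+ r * (2 * #|J|)%:R.
  apply: le_trans (_ : _ <= expR (8 * (th * K * tau) ^+ 2) ^+ r *
      #|((J * bool)%type : finType)|%:R) _; last first.
    by rewrite card_prod card_bool mulnC.
  apply: le_trans hv; have [D0|D0] := leP 0 D.
    rewrite (bigD1 (j, true)) //=.
    under eq_bigr do rewrite expr1 -scalemxAl mxE.
    rewrite -mulr_sumr rD mulN1r opprK (ger0_norm D0).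
    by rewrite lerDl; apply: sumr_ge0 => l _; exact: expR_ge0.
  rewrite (bigD1 (j, false)) //=.
  under eq_bigr do rewrite expr0 scale1r.
  rewrite rD (ltr0_norm D0) mulrN.
  by rewrite lerDl; apply: sumr_ge0 => l _; exact: expR_ge0.
have J0 : (0 < #|J|)%N by apply/card_gt0P; exists j.
have e2 : th * (r%:R * `|D|) <= 8 * (th * K * tau) ^+ 2 * r%:R + ln ((2 * #|J|)%:R : R).
  rewrite -ler_expR expRD expRM_natr lnK ?posrE ?ltr0n ?muln_gt0 //.
have e3 : th * (r%:R * d / 2) >= ln ((2 * #|J|)%:R : R).
  have -> : th * (r%:R * d / 2) = r%:R * d ^+ 2 / (32 * (K ^+ 2 * tau ^+ 2)).
    by rewrite /th; field; rewrite !gt_eqF.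
  rewrite ler_pdivlMr ?mulr_gt0 ?exprn_gt0 //; apply: le_trans hr.
  by rewrite le_eqVlt; apply/orP; left; apply/eqP; ring.
have e4 : 8 * (th * K * tau) ^+ 2 * r%:R = th * (r%:R * d / 2).
  by rewrite /th; field; rewrite !gt_eqF.
have : th * (r%:R * `|D|) <= th * (r%:R * d) by lra.
by rewrite !ler_pM2l.
Qed.

End Maurey.

(** * A finite l2-net of the sparse unit ball *)

Section Grid.
Variables (R : realType) (k s : nat).
Hypotheses (s0 : (0 < s)%N) (k0 : (0 < k)%N).

(* The second index of a pair encodes a multiple of [1 / (8 s)] in [[-1, 1]]. *)
Definition grid := {ffun 'I_s -> 'I_k * 'I_(16 * s).+1}.

Definition grid_coord (c : 'I_(16 * s).+1) : R := (c%:R - (8 * s)%:R) / (8 * s)%:R.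

Definition grid_pt (g : grid) : 'cV[R]_k :=
  \sum_i grid_coord (g i).2 *: delta_mx (g i).1 0.

Lemma grid_pt_sparse g : sparse s (grid_pt g).
Proof.
apply: (@leq_trans #|[set (g i).1 | i : 'I_s]|); last first.
  by apply: leq_trans (leq_imset_card _ _) _; rewrite card_ord.
apply/subset_leq_card/fintype.subsetP => j; rewrite inE => h.
apply: contraT => nj; case/eqP: h; rewrite summxE big1 // => i _.
rewrite mxE mxE andbT; case: eqP => [e|]; last by rewrite mulr0.
by case/negP: nj; apply/imsetP; exists i.
Qed.

(** Each coordinate is rounded towards 0 to a multiple of [1 / (8 s)]: zeros are kept, the norm does
    not increase, and the squared error is at most [s / (8 s)^2 <= 1/64]. *)
Lemma grid_net (x : 'cV[R]_k) : sparse_ball s x -> exists g : grid,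
  (forall i, x i 0 = 0 -> grid_pt g i 0 = 0) /\
  l2norm (grid_pt g) ^+ 2 <= 1 /\ l2norm (x - grid_pt g) ^+ 2 <= 64^-1.
Proof.
move=> [sx nx].
have xle i : `|x i 0| <= 1 by exact: le_norm_l2norm.
have sR : 0 < (8 * s)%:R :> R by rewrite ltr0n muln_gt0.
pose n i := Num.trunc ((8 * s)%:R * `|x i 0|).
have n1 i : (n i)%:R <= (8 * s)%:R * `|x i 0| by rewrite truncn_le mulr_ge0.
have n2 i : (8 * s)%:R * `|x i 0| < (n i).+1%:R by exact: truncnS_gt.
have n8 i : (n i <= 8 * s)%N.
  rewrite -(ler_nat R); apply: (le_trans (n1 i)).
  by rewrite ler_piMr.
pose c i : 'I_(16 * s).+1 := inord (if 0 <= x i 0 then (8 * s + n i)%N else (8 * s - n i)%N).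
pose y i := grid_coord (c i).
have c16 i : ((if (0 <= x i 0)%R then 8 * s + n i else 8 * s - n i) <= 16 * s)%N.
  case: ifP => _; last by rewrite (leq_trans (leq_subr _ _)) // leq_mul2r orbT.
  by rewrite (leq_trans (leq_add (leqnn _) (n8 i))) // -mulnDl.
have yE i : y i = (if 0 <= x i 0 then 1 else -1) * (n i)%:R / (8 * s)%:R.
  rewrite /y /grid_coord inordK ?ltnS //; case: ifP => _.
    by rewrite natrD addrAC subrr add0r mul1r.
  by rewrite natrB // addrAC subrr add0r mulN1r.
have yx i : `|x i 0 - y i| <= (8 * s)%:R^-1.
  have h1 := n1 i; have h2 := n2 i; rewrite -natr1 in h2.
  rewrite yE -(ler_pM2l sR) mulfV ?gt_eqF // -[X in X * _](gtr0_norm sR) -normrM mulrBr.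
  rewrite [(8 * s)%:R * (_ / _)]mulrC divfK ?gt_eqF //.
  case: ifP => hx; rewrite ?mul1r ?mulN1r ?opprK.
    by rewrite (ger0_norm hx) in h1 h2; rewrite ger0_norm; lra.
  have hx' : x i 0 < 0 by rewrite ltNge hx.
  by rewrite (ltr0_norm hx') in h1 h2; rewrite ler0_norm; lra.
have yle i : `|y i| <= `|x i 0|.
  rewrite yE !normrM normfV (gtr0_norm sR) ler_pdivrMr // [leRHS]mulrC normr_nat.
  by case: ifP => _; rewrite ?normrN normr1 mul1r.
have y0 i : x i 0 = 0 -> y i = 0.
  by move=> h; have := yle i; rewrite h normr0 normr_le0 => /eqP.
pose e := enum [pred i | x i 0 != 0].
have se : (size e <= s)%N by rewrite -cardE.
pose i0 : 'I_k := Ordinal k0.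
(* Slots beyond the support hold the code [8 s], which stands for the coefficient 0. *)
pose g : grid := [ffun i : 'I_s =>
  if (i < size e)%N then (nth i0 e i, c (nth i0 e i)) else (i0, inord (8 * s))].
have gE j : grid_pt g j 0 = y j.
  have -> : grid_pt g = \sum_(j | x j 0 != 0) y j *: delta_mx j 0.
    transitivity (\sum_(j <- e) y j *: (delta_mx j 0 : 'cV[R]_k)); last first.
      by rewrite /e big_enum; apply: eq_bigl => l; rewrite inE.
    transitivity (\sum_(i < size e) y (nth i0 e i) *: (delta_mx (nth i0 e i) 0 : 'cV[R]_k)).
      rewrite (big_ord_widen _ (fun i => y (nth i0 e i) *: (delta_mx (nth i0 e i) 0 : 'cV[R]_k)) se).
      rewrite [RHS]big_mkcond; apply: eq_bigr => i _; rewrite ffunE; case: ifP => //= _.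
      rewrite /grid_coord inordK ?subrr ?mul0r ?scale0r //.
      by rewrite ltnS leq_mul2r orbT.
    rewrite [RHS](big_nth i0) big_mkord.
    by [].
  rewrite summxE; have [xj|xj] := boolP (x j 0 != 0).
    rewrite (bigD1 j) //= big1 => [|l /andP[_ /negbTE lj]].
      by rewrite !mxE !eqxx mulr1 addr0.
    by rewrite !mxE eq_sym lj mulr0.
  rewrite big1 => [|l xl]; first by rewrite y0 //; apply/eqP; rewrite -[_ == _]negbK.
  rewrite !mxE; case: eqP => [jl|_]; last by rewrite mulr0.
  by rewrite jl xl in xj.
exists g; split=> [i xi|]; first by rewrite gE y0.
split.
  apply: le_trans nx; rewrite !l2norm_sqr; apply: ler_sum => i _; rewrite gE.
  rewrite -[leLHS]real_normK ?num_real // -[leRHS]real_normK ?num_real //.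
  by rewrite lerXn2r ?nnegrE.
rewrite l2norm_sqr.
apply: (@le_trans _ _ (\sum_(i | x i 0 != 0) ((8 * s)%:R^-1) ^+ 2)).
  rewrite [leRHS]big_mkcond; apply: ler_sum => i _; rewrite !mxE gE.
  case: ifPn => [_|]; last by rewrite negbK => /eqP xi; rewrite y0 // xi subrr expr0n.
  rewrite -[leLHS]real_normK ?num_real // lerXn2r ?nnegrE ?invr_ge0 //.
rewrite sumr_const -[leLHS]mulr_natl.
apply: (@le_trans _ _ (s%:R * (8 * s)%:R^-1 ^+ 2)).
  by rewrite ler_wpM2r ?sqr_ge0 // ler_nat.
rewrite natrM; have s1 : 1 <= s%:R :> R by rewrite ler1n.
have -> : s%:R * (8 * s%:R)^-1 ^+ 2 = 64^-1 * s%:R^-1 :> R by field; rewrite gt_eqF ?ltr0n.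
by rewrite ler_piMr ?invr_ge0 // invf_le1 ?ltr0n.
Qed.

End Grid.

(** * Numerical bounds on logarithms *)

Section Logs.
Variable R : realType.

Lemma half_le_ln2 : 2^-1 <= ln (2 : R).
Proof.
rewrite -[leLHS]expRK ler_ln ?posrE ?expR_gt0 //.
have h : 1 - 2^-1 <= (expR 2^-1 : R)^-1 by rewrite -expRN; exact: expR_ge1Dx.
have e0 := expR_gt0 (2^-1 : R).
have : (1 - 2^-1) * expR 2^-1 <= 1 :> R by rewrite -ler_pdivlMr // div1r.
lra.
Qed.

Lemma half_le_ln n : (2 <= n)%N -> 2^-1 <= ln (n%:R : R).
Proof.
move=> n2; apply: (le_trans half_le_ln2).
by rewrite ler_ln ?posrE ?ltr0n ?ler_nat // (leq_trans _ n2).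
Qed.

Lemma ln_natM m n : (0 < m)%N -> (0 < n)%N ->
  ln ((m * n)%:R : R) = ln (m%:R : R) + ln (n%:R : R).
Proof. by move=> m0 n0; rewrite natrM lnM ?posrE ?ltr0n. Qed.

Lemma ln_natX m n : (0 < m)%N -> ln ((m ^ n)%:R : R) = n%:R * ln (m%:R : R).
Proof. by move=> m0; rewrite natrX lnXn ?ltr0n // mulr_natl. Qed.

Lemma ler_ln_nat m n : (0 < m)%N -> (m <= n)%N -> ln (m%:R : R) <= ln (n%:R : R).
Proof.
by move=> m0 mn; rewrite ler_ln ?posrE ?ltr0n ?ler_nat // (leq_trans m0).
Qed.

(** The left side is the number of links of the chains below; its square is the origin of the factor
    [log^2 s]. *)
Lemma trunc_log_le_ln s : (2 <= s)%N -> ((trunc_log 2 s).+2)%:R <= 6 * ln (s%:R : R).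
Proof.
move=> s2; have s0 : (0 < s)%N by apply: leq_trans s2.
have /andP[h _] := trunc_log_bounds (isT : (1 < 2)%N) s0.
have := @ler_ln_nat (2 ^ trunc_log 2 s) s; rewrite expn_gt0 => /(_ isT h).
rewrite ln_natX // -[(trunc_log 2 s).+2]addn2 natrD => h2; have h3 := half_le_ln s2.
have := ler_wpM2l (ler0n R (trunc_log 2 s)) half_le_ln2; lra.
Qed.

End Logs.

(** * The Rademacher process of sparse quadratic forms *)

Section RademacherSparse.
Variables (R : realType) (I J : finType) (k s q : nat).
Variables (b : J -> 'rV[R]_k) (g : I -> J) (K : R).
Hypotheses (bK : forall j i, `|b j 0 i| <= K) (K0 : 0 < K).
Hypotheses (s2 : (2 <= s)%N) (sk : (s <= k)%N) (J2 : (2 <= #|J|)%N) (q0 : (0 < q)%N).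
Hypothesis hq : ln (s%:R : R) ^+ 2 * ln (k%:R : R) * ln (#|J|%:R : R) <= q%:R.

Let tau : R := Num.sqrt s%:R.
Let s0 : (0 < s)%N. Proof. exact: leq_trans s2. Qed.
Let k2 : (2 <= k)%N. Proof. exact: leq_trans sk. Qed.
Let k0 : (0 < k)%N. Proof. exact: leq_trans k2. Qed.
Let J0 : (0 < #|J|)%N. Proof. exact: leq_trans J2. Qed.
Let tau2 : tau ^+ 2 = s%:R. Proof. by rewrite sqr_sqrtr. Qed.
Let tau0 : 0 < tau. Proof. by rewrite sqrtr_gt0 ltr0n. Qed.
Let V : R := sparse_norm s (\sum_i (b (g i))^T *m b (g i)).
Let V0 : 0 <= V. Proof. exact: sparse_norm_ge0. Qed.

(** Cauchy-Schwarz on the support, as Jensen's inequality for squares with weight [s^-1] on each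
    nonzero coordinate. *)
Lemma sparse_ball_l1 (x : 'cV[R]_k) : sparse_ball s x -> \sum_i `|x i 0| <= tau.
Proof.
move=> [sx nx].
have sR : 0 < s%:R :> R by rewrite ltr0n.
pose w i : R := if x i 0 != 0 then s%:R^-1 else 0.
have w0 i : 0 <= w i by rewrite /w; case: ifP; rewrite ?invr_ge0.
have w1 : \sum_i w i <= 1.
  rewrite /w -big_mkcond sumr_const -[leLHS]mulr_natl ler_pdivrMr // mul1r ler_nat.
  exact: sx.
have wE i n : (0 < n)%N -> w i * `|x i 0| ^+ n = s%:R^-1 * `|x i 0| ^+ n.
  by rewrite /w; case: n => // n _; case: eqP => // ->; rewrite normr0 expr0n !mulr0.
have := @pow_jensen _ _ w (fun i => `|x i 0|) 2 isT w0 w1 (fun i => normr_ge0 _).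
under eq_bigr do rewrite -[`|_|]expr1 wE // expr1.
under [leRHS]eq_bigr do rewrite wE // real_normK ?num_real //.
rewrite -!mulr_sumr -l2norm_sqr => h.
rewrite -(@ler_pXn2r _ 2) ?nnegrE ?sumr_ge0 ?(ltW tau0) // tau2.
rewrite exprMn expr2 -mulrA ler_pM2l ?invr_gt0 // in h.
have := le_trans h nx.
by rewrite mulrC ler_pdivrMr // mul1r.
Qed.

Lemma mul_le_l1 j (x : 'cV[R]_k) : sparse_ball s x -> `|(b j *m x) 0 0| <= K * tau.
Proof.
move=> Dx; rewrite mxE; apply: (le_trans (ler_norm_sum _ _ _)).
apply: (@le_trans _ _ (\sum_i K * `|x i 0|)).
  by apply: ler_sum => i _; rewrite normrM ler_wpM2r.
by rewrite -mulr_sumr ler_wpM2l ?(ltW K0) // sparse_ball_l1.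
Qed.

Lemma sum_sqr_le_V (x : 'cV[R]_k) : sparse_ball s x ->
  \sum_i (b (g i) *m x) 0 0 ^+ 2 <= V.
Proof.
move=> Dx; under eq_bigr do rewrite -qform_outer.
by rewrite -qform_sum; apply: le_trans (le_sparse_norm _ Dx); exact: ler_norm.
Qed.

(** The difference of squares factors as [(X - Y) (X + Y)]: the first factor is uniformly at most
    [D], and the squares of the second add up to at most [4 V]. *)
Lemma increment_le (x y : 'cV[R]_k) D : sparse_ball s x -> sparse_ball s y ->
  (forall j, `|(b j *m (x - y)) 0 0| <= D) ->
  \sum_i ((b (g i) *m x) 0 0 ^+ 2 - (b (g i) *m y) 0 0 ^+ 2) ^+ 2 <= 4 * D ^+ 2 * V.
Proof.
move=> Dx Dy hD; have hx := sum_sqr_le_V Dx; have hy := sum_sqr_le_V Dy.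
apply: (@le_trans _ _ (\sum_i D ^+ 2 * (2 * (b (g i) *m x) 0 0 ^+ 2 +
    2 * (b (g i) *m y) 0 0 ^+ 2))).
  apply: ler_sum => i _; set X := (_ *m x) 0 0; set Y := (_ *m y) 0 0.
  have := hD (g i); rewrite mulmxBr mxE [X in _ + X]mxE -/X -/Y => h.
  have h2 : (X - Y) ^+ 2 <= D ^+ 2.
    rewrite -[leLHS]real_normK ?num_real // lerXn2r ?nnegrE //.
    exact: le_trans h.
  rewrite (_ : (X ^+ 2 - Y ^+ 2) ^+ 2 = (X - Y) ^+ 2 * (X + Y) ^+ 2); last by ring.
  apply: (@le_trans _ _ (D ^+ 2 * (X + Y) ^+ 2)); first by rewrite ler_wpM2r ?sqr_ge0.
  rewrite ler_wpM2l ?sqr_ge0 //; have := sqr_ge0 (X - Y); nra.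
rewrite -mulr_sumr big_split /= -!mulr_sumr.
have := sqr_ge0 D; nra.
Qed.

Let T := {x : grid k s | l2norm (grid_pt R x) ^+ 2 <= 1}.
Let pt (x : T) : 'cV[R]_k := grid_pt R (val x).
Let pt_ball x : sparse_ball s (pt x).
Proof. by split; [exact: grid_pt_sparse|exact: (valP x)]. Qed.
Let c (x : T) (i : I) : R := (b (g i) *m pt x) 0 0 ^+ 2.

Lemma net_origin : exists x : T, pt x = 0.
Proof.
have [x [h1 [h2 _]]] := grid_net s0 k0 (@sparse_ball0 R k s).
exists (exist _ x h2); apply/colP => i; rewrite mxE /pt /= h1 //.
by rewrite mxE.
Qed.

Lemma card_net : (#|{: T}| <= (k * (16 * s).+1) ^ s)%N.
Proof.
by rewrite card_sig (leq_trans (max_card _)) // card_ffun card_prod !card_ord.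
Qed.

(** At the radius [d l], Maurey's method takes [r l = 4^l n0] atoms, where [n0] exceeds
    [32 ln (2 #|J|)]. As [s < 2 ^ L], the entropy of the whole grid is dominated at level [L], and
    the chain may then end with all of [T]. *)
Let L := (trunc_log 2 s).+1.
Let n0 := (Num.trunc (32 * ln ((2 * #|J|)%:R : R))).+1.
Let r l := (4 ^ l * n0)%N.
Let d l : R := K * tau / 2 ^+ l.
Let d0 l : 0 < d l. Proof. by rewrite divr_gt0 ?mulr_gt0 ?exprn_gt0. Qed.

Let lnJ : 2^-1 <= ln (#|J|%:R : R). Proof. exact: half_le_ln. Qed.
Let lnk : 2^-1 <= ln (k%:R : R). Proof. exact: half_le_ln. Qed.
Let ell : R := ln (k%:R : R) * ln (#|J|%:R : R).

Let ell0 : 0 <= ell.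
Proof. by apply: mulr_ge0; [move: lnk|move: lnJ]; lra. Qed.

Let n0_le : n0%:R <= 66 * ln (#|J|%:R : R).
Proof.
have h0 : 0 <= 32 * ln ((2 * #|J|)%:R : R).
  by rewrite mulr_ge0 // ln_ge0 // ler1n muln_gt0.
have := truncn_le (32 * ln ((2 * #|J|)%:R : R)); rewrite h0 => h.
rewrite /n0 -addn1 natrD; apply: (le_trans (lerD h (lexx 1))).
rewrite ln_natM ?J0 //; have := ler_ln_nat R (isT : (0 < 2)%N) J2; have := lnJ; lra.
Qed.

Lemma maurey_net l x : exists v : (r l).-tuple ('I_k * bool),
  forall j, `|(b j *m (pt x - maurey_point tau v)) 0 0| <= d l.
Proof.
apply: (maurey bK K0 tau0 (d0 l) k0).
- exact: sparse_ball_l1 (pt_ball x).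
- by rewrite muln_gt0 expn_gt0.
- rewrite [leRHS](_ : _ = K ^+ 2 * (tau ^+ 2 * n0%:R)); last first.
    rewrite /r natrM natrX /d (_ : 4 = 2 ^+ 2 :> R); last by ring.
    by rewrite -exprM mulnC exprM; field; rewrite expf_neq0.
  rewrite [leLHS](_ : _ = K ^+ 2 * (tau ^+ 2 * (32 * ln ((2 * #|J|)%:R : R)))); last by ring.
  by rewrite !ler_pM2l ?exprn_gt0 // ltW // truncnS_gt.
Qed.

Let code l (x : T) : (r l).-tuple ('I_k * bool) := projT1 (cid (maurey_net l x)).
Let codeP l x j : `|(b j *m (pt x - maurey_point tau (code l x))) 0 0| <= d l.
Proof. by rewrite /code; case: cid. Qed.

Let x0 : T := projT1 (cid net_origin).
Let pt0 : pt x0 = 0. Proof. by rewrite /x0; case: cid. Qed.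

(** Each class of points with the same code is sent to one of its members: unlike Maurey's points,
    which need not be sparse, it lies in the net, at the price of twice the radius. Chains start at
    the origin and reach the identity at [L.+1]. *)
Let pi l (x : T) : T := if l == 0%N then x0 else
  if (l <= L)%N then odflt x0 [pick y | code l y == code l x] else x.

Let piP l x j : `|(b j *m (pt x - pt (pi l x))) 0 0| <= 2 * d l.
Proof.
rewrite /pi; case: eqP => [->|_].
  rewrite pt0 subr0; apply: (le_trans (mul_le_l1 j (pt_ball x))).
  by rewrite /d expr0 divr1 ler_peMl ?ler1n // mulr_ge0 // ltW.
case: ifP => _; last by rewrite subrr mulmx0 mxE normr0 mulr_ge0 // ltW.
case: pickP => [y /eqP yx|/(_ x)]; last by rewrite eqxx.
rewrite (_ : pt x - pt y = (pt x - maurey_point tau (code l x)) -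
  (pt y - maurey_point tau (code l y))); last first.
  by rewrite yx opprB addrA subrK.
rewrite mulmxBr mxE [X in _ + X]mxE (le_trans (ler_normB _ _)) //.
by rewrite mulr_natl mulr2n lerD.
Qed.

Let card_pi l : (l <= L)%N -> (#|[set pi l x | x in [set: T]]| <= (2 * k) ^ r l)%N.
Proof.
move=> lL; rewrite /pi lL; case: eqP => _.
  apply: (@leq_trans #|[set x0]|).
    by apply/subset_leq_card/fintype.subsetP => y /imsetP[x _ ->]; rewrite inE.
  by rewrite cards1 expn_gt0 muln_gt0 k0.
pose f v := odflt x0 [pick y | code l y == v].
apply: (@leq_trans #|[set f v | v in [set: (r l).-tuple ('I_k * bool)]]|).
  apply/subset_leq_card/fintype.subsetP => y /imsetP[x _ ->].
  by apply/imsetP; exists (code l x).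
apply: leq_trans (leq_imset_card _ _) _.
by rewrite cardsT card_tuple card_prod card_ord card_bool mulnC.
Qed.

Let link l := [set (pi l x, pi l.+1 x) | x in [set: T]].

Let card_link l : (#|link l| <=
  #|[set pi l x | x in [set: T]]| * #|[set pi l.+1 x | x in [set: T]]|)%N.
Proof.
rewrite -cardsX; apply/subset_leq_card/fintype.subsetP => y /imsetP[x _ ->].
by rewrite finset.in_setX /= !imset_f.
Qed.

Let link_gt0 l : (0 < #|link l|)%N.
Proof. by apply/card_gt0P; exists (pi l x0, pi l.+1 x0); apply/imsetP; exists x0. Qed.

(** Links are at most as many as pairs of points of two consecutive nets. The codes of level [m]
    contribute [132 * 4 ^ m], and [660 = 132 * (1 + 4)]. *)
Lemma ln_card_link l : (l < L.+1)%N -> ln (#|link l|%:R : R) <= 660 * 4 ^+ l * ell.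
Proof.
rewrite ltnS => lL.
have k0' := k0.
have lr : 0 < ln (2 : R) by have := half_le_ln2 R; lra.
have l2k : ln ((2 * k)%:R : R) <= 2 * ln (k%:R : R).
  by rewrite ln_natM //; have := ler_ln_nat R (isT : (0 < 2)%N) k2; lra.
have code_le m : ln (((2 * k) ^ r m)%:R : R) <= 132 * 4 ^+ m * ell.
  rewrite ln_natX ?muln_gt0 // /r natrM natrX.
  have h1 : n0%:R * ln ((2 * k)%:R : R) <= 66 * ln (#|J|%:R : R) * (2 * ln (k%:R : R)).
    apply: ler_pM; [exact: ler0n| |exact: n0_le|exact: l2k].
    by rewrite ln_ge0 // ler1n muln_gt0.
  rewrite -mulrA (_ : 132 * 4 ^+ m * ell =
    4 ^+ m * (66 * ln (#|J|%:R : R) * (2 * ln (k%:R : R)))); last by rewrite /ell; ring.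
  by rewrite ler_wpM2l // exprn_ge0.
have p4 m : 0 <= 4 ^+ m * ell by rewrite mulr_ge0 // exprn_ge0.
(* The last link ends in the whole net, whose log-cardinality is bounded by [card_net] and
   [s <= 4 ^ L]. *)
move: lL; rewrite leq_eqVlt => /predU1P[lL|lL].
  have : (#|link l| <= (2 * k) ^ r l * (k * (16 * s).+1) ^ s)%N.
    apply: (leq_trans (card_link l)); apply: leq_mul; first by rewrite card_pi ?lL.
    by apply: leq_trans card_net; exact: max_card.
  move/(ler_ln_nat R (link_gt0 l))/le_trans; apply.
  rewrite ln_natM ?expn_gt0 ?muln_gt0 ?k0 //.
  have h2 : ln (((k * (16 * s).+1) ^ s)%:R : R) <= 14 * 4 ^+ l * ell.
    rewrite ln_natX ?muln_gt0 ?k0 //.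
    have h3 : ln ((k * (16 * s).+1)%:R : R) <= 7 * ln (k%:R : R).
      rewrite ln_natM //.
      have : ((16 * s).+1 <= 2 ^ 5 * k)%N.
        apply: (@leq_trans (32 * s)); last by rewrite leq_mul2l.
        by rewrite -[32%N]/(16 + 16)%N mulnDl -addn1 leq_add2l muln_gt0.
      move/(ler_ln_nat R (ltn0Sn _)); rewrite ln_natM // ln_natX //.
      have := ler_ln_nat R (isT : (0 < 2)%N) k2; lra.
    have h4 : s%:R <= 4 ^+ l :> R.
      rewrite -natrX ler_nat lL; apply: (@leq_trans (2 ^ L)).
        by rewrite ltnW // trunc_log_ltn.
      by rewrite leq_exp2r.
    have h5 : 7 * ln (k%:R : R) <= 14 * ell by rewrite /ell; move: lnJ lnk; nra.
    rewrite [14 * _]mulrC -mulrA; apply: ler_pM => //; last exact: le_trans h5.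
    by rewrite ln_ge0 // ler1n muln_gt0 k0.
  have := code_le l; have := p4 l; lra.
have : (#|link l| <= (2 * k) ^ r l * (2 * k) ^ r l.+1)%N.
  by apply: (leq_trans (card_link l)); apply: leq_mul; apply: card_pi => //; exact: ltnW.
move/(ler_ln_nat R (link_gt0 l))/le_trans; apply.
rewrite ln_natM ?expn_gt0 ?muln_gt0 ?k0 //.
have := code_le l; have := code_le l.+1; rewrite exprS; lra.
Qed.

(** The multiplier of the moment order in [chaining]: positive thanks to the successor, it brings
    [rr l * q] above the bound on the log-cardinality, by at most [q]. *)
Let rr l := (Num.trunc (660 * 4 ^+ l * ell / q%:R)).+1.

Let rr_bounds l : 660 * 4 ^+ l * ell <= (rr l * q)%:R <= 660 * 4 ^+ l * ell + q%:R.
Proof.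
have qR : 0 < q%:R :> R by rewrite ltr0n.
have e0 : 0 <= 660 * 4 ^+ l * ell / q%:R.
  apply: divr_ge0; last exact: ltW.
  by apply: mulr_ge0; [apply: mulr_ge0; [exact: ler0n|exact: exprn_ge0]|exact: ell0].
rewrite /rr natrM; set t := 660 * 4 ^+ l * ell in e0 *.
rewrite -ler_pdivrMr // (ltW (truncnS_gt _)) /=.
have := truncn_le (t / q%:R); rewrite e0 => h.
by rewrite -natr1 mulrDl mul1r lerD2r -ler_pdivlMr.
Qed.

(* The geometric part pays for the moment order [q], the uniform part for the
   log-cardinalities, whose product with the squared radius is the same at all
   scales: purely uniform weights would cost a factor [log^2 s] on [q]. *)
Let w l : R := (2^-1 ^+ l.+1 + L.+1%:R^-1) / 2.

Let sum_w : \sum_(l < L.+1) w l <= 1.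
Proof.
rewrite -mulr_suml big_split /= sumr_const card_ord -[X in _ + X]mulr_natl mulfV ?pnatr_eq0 //.
have -> : \sum_(l < L.+1) (2^-1 : R) ^+ l.+1 = 1 - 2^-1 ^+ L.+1.
  elim: (L.+1) => [|m ih]; first by rewrite big_ord0 subrr.
  by rewrite big_ord_recr /= ih exprS; field.
have := half_exp_ge0 R L.+1; lra.
Qed.

(* Locked because [done] would otherwise compute with the unary numerals. *)
Definition rad_sparse_cst : R :=
  locked (16 * 36 * (660 * 36) * (khintchine_cst R * expR 1)).

Lemma rad_sparse_cst_gt0 : 0 < rad_sparse_cst.
Proof.
rewrite /rad_sparse_cst -lock.
apply: mulr_gt0; last by rewrite mulr_gt0 ?expR_gt0 ?khintchine_cst_gt0.
by apply: mulr_gt0; apply: mulr_gt0; rewrite ltr0n.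
Qed.

(** The division by 4 makes room for the factor 2 of [sparse_norm_net], which gets squared. *)
Let B : R := rad_sparse_cst / 4 * (K ^+ 2 * s%:R * q%:R * V).
Let B0 : 0 <= B.
Proof.
apply: mulr_ge0; first by apply: divr_ge0; [exact: ltW rad_sparse_cst_gt0|exact: ler0n].
by apply: mulr_ge0 => //; apply: mulr_ge0 => //; apply: mulr_ge0 => //; exact: sqr_ge0.
Qed.

(** This is [4 (3 d l)^2 V]: a link is at most [2 d l + 2 d l.+1 = 3 d l] long. *)
Let v l : R := 36 * K ^+ 2 * s%:R * V * 4^-1 ^+ l.

Let level_le l : (l < L.+1)%N ->
  khintchine_cst R * expR 1 * (rr l * q)%:R * v l <= w l ^+ 2 * B.
Proof.
move=> lL; have /andP[_ h] := rr_bounds l.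
set c2 := khintchine_cst R * expR 1.
set A : R := 660 * 36; have A4 : 4 <= A by rewrite /A; lra.
have c20 : 0 < c2 by rewrite mulr_gt0 ?khintchine_cst_gt0 ?expR_gt0.
set P := K ^+ 2 * s%:R * V; have P0 : 0 <= P.
  by apply: mulr_ge0 => //; apply: mulr_ge0 => //; exact: sqr_ge0.
have LR : 0 < L.+1%:R :> R by rewrite ltr0n.
set a := L.+1%:R ^- 2 : R; set z := (4^-1 : R) ^+ l.
have a0 : 0 <= a by rewrite invr_ge0 exprn_ge0.
have z0 : 0 <= z by rewrite exprn_ge0 // invr_ge0.
(* The assumption [hq] pays for the square of the number of links, as [L.+1 <= 6 ln s]. *)
have hl : ell <= 36 * q%:R * a.
  rewrite /a ler_pdivlMr ?exprn_gt0 //.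
  have h6 : L.+1%:R ^+ 2 <= (6 * ln (s%:R : R)) ^+ 2.
    rewrite lerXn2r ?nnegrE ?(ltW LR) ?trunc_log_le_ln // mulr_ge0 // ln_ge0 //.
    by rewrite ler1n.
  apply: (le_trans (ler_wpM2l ell0 h6)); move: hq; rewrite /ell; nra.
have zE : 4 ^+ l * z = 1 by rewrite -exprMn mulfV ?expr1n // pnatr_eq0.
have h1 : (rr l * q)%:R * z <= A * q%:R * a + q%:R * z.
  apply: (le_trans (ler_wpM2r z0 h)).
  rewrite mulrDl (_ : _ * ell * z = 660 * (4 ^+ l * z) * ell); last by ring.
  by rewrite zE /A; lra.
have hw : 4^-1 * (z / 4 + a) <= w l ^+ 2.
  rewrite /w; set y := 2^-1 ^+ l.+1; set t := L.+1%:R^-1.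
  have y0 : 0 <= y by exact: half_exp_ge0.
  have t0 : 0 <= t by rewrite invr_ge0.
  have -> : z / 4 = y ^+ 2.
    rewrite /z /y (_ : 4^-1 = 2^-1 ^+ 2 :> R); last by field.
    rewrite -!exprM -exprD; congr (_ ^+ _).
    by rewrite [RHS]mulSn addnC mulnC.
  have -> : a = t ^+ 2 by rewrite /a /t exprVn.
  nra.
apply: (@le_trans _ _ (4^-1 * (z / 4 + a) * B)); last first.
  exact: ler_wpM2r B0 _ _ hw.
rewrite (_ : _ * v l = 36 * c2 * P * ((rr l * q)%:R * z)); last first.
  by rewrite /v /P -/z; ring.
have h2 : 36 * c2 * P * ((rr l * q)%:R * z) <= 36 * c2 * P * (A * q%:R * a + q%:R * z).
  by rewrite ler_wpM2l // !mulr_ge0 // ltW.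
apply: (le_trans h2); rewrite -subr_ge0.
(* The constant is tuned so that the uniform parts cancel; the geometric remainder is nonnegative
   since [A >= 4]. *)
rewrite (_ : _ - _ = 36 * c2 * P * (q%:R * z) * (A / 4 - 1)); last first.
  by rewrite /B /rad_sparse_cst -lock -/c2 -/A /P; field.
apply: mulr_ge0; last first.
  by rewrite subr_ge0 ler_pdivlMr // mul1r.
apply: mulr_ge0; last by apply: mulr_ge0; [exact: ler0n|].
by apply: mulr_ge0 => //; apply: mulr_ge0; [exact: ler0n|exact: ltW].
Qed.

(** On the net, the signed form at [x] is the Rademacher sum with coefficients [(b_i x)^2], so
    [sparse_norm_net] reduces the norm to a maximum that [chaining] bounds. *)
Lemma rademacher_sparse_norm :
  rad_avg (fun e : {ffun I -> bool} => sparse_norm s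
    (\sum_i (-1) ^+ e i *: ((b (g i))^T *m b (g i))) ^+ (2 * q)) <=
  (rad_sparse_cst * (K ^+ 2 * s%:R * q%:R * V)) ^+ q.
Proof.
have T0 : (0 < #|{: T}|)%N by apply/card_gt0P; exists x0.
have chain : rad_avg (fun e => (\big[Num.max/0]_x `|rad_sum (c x) e|) ^+ (2 * q)) <= B ^+ q.
  apply: (@chaining R I T c L.+1 q pi w v rr) => //.
  - by move=> x; rewrite /pi ltnn.
  - by move=> x i; rewrite /pi eqxx /c pt0 mulmx0 mxE expr0n.
  - move=> l x lL.
    have := @increment_le (pt (pi l.+1 x)) (pt (pi l x)) (3 * d l) (pt_ball _) (pt_ball _) _.
    rewrite (_ : 4 * _ * V = v l); last first.
      rewrite /v /d (_ : 4^-1 = (2 ^+ 2)^-1 :> R); last by field.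
      by rewrite -tau2 exprVn -exprM mulnC exprM; field; rewrite expf_neq0.
    apply=> j.
    rewrite (_ : _ - _ = (pt x - pt (pi l x)) - (pt x - pt (pi l.+1 x))); last first.
      by rewrite opprB [RHS]addrC addrA subrK.
    rewrite mulmxBr mxE [X in _ + X]mxE (le_trans (ler_normB _ _)) //.
    apply: (le_trans (lerD (piP l x j) (piP l.+1 x j))).
    rewrite (_ : d l.+1 = d l / 2); first by have := d0 l; lra.
    by rewrite /d exprS; field; rewrite expf_neq0.
  - move=> l lL; split => //; apply: (le_trans (ln_card_link lL)).
    by have /andP[] := rr_bounds l.
  - by move=> l; rewrite divr_gt0 // ltr_wpDl // ?half_exp_ge0 // invr_gt0 ltr0n.
have -> : rad_sparse_cst * (K ^+ 2 * s%:R * q%:R * V) = 2 ^+ 2 * B.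
  by rewrite /B; move: rad_sparse_cst (_ * V) => u z; field.
rewrite exprMn -exprM; apply: le_trans (ler_wpM2l _ chain); last by rewrite exprn_ge0.
rewrite -rad_avgZ; apply: le_rad_avg => e; rewrite -exprMn.
apply: lerXn2r; rewrite ?nnegrE ?sparse_norm_ge0 // ?mulr_ge0 // ?bigmax_ge_id //.
apply: (@sparse_norm_net _ _ _ _ _ pt).
- rewrite linear_sum; apply: eq_bigr => i _.
  by rewrite linearZ /= trmx_mul trmxK.
- move=> x Dx; have [y [h1 [h2 h3]]] := grid_net s0 k0 Dx.
  by exists (exist _ y h2).
- move=> x _; rewrite qform_sum.
  rewrite (_ : \sum_i _ = rad_sum (c x) e); last first.
    by apply: eq_bigr => i _; rewrite qformZ qform_outer.
  exact: (le_bigmax 0 (fun x => `|rad_sum (c x) e|) x).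
Qed.

End RademacherSparse.

(** * Symmetrization for finite product laws *)

Section Symmetrization.
Variables (R : realType) (I F : finType) (mu : I -> F -> R).
Hypotheses (mu0 : forall i x, 0 <= mu i x) (mu1 : forall i, \sum_x mu i x = 1).

Definition prod_weight (w : {ffun I -> F}) : R := \prod_i mu i (w i).

Lemma prod_weight_ge0 w : 0 <= prod_weight w.
Proof. by apply: prodr_ge0. Qed.

Lemma sum_prod_weight : \sum_w prod_weight w = 1.
Proof. by rewrite -bigA_distr_bigA /= big1. Qed.

Lemma prod_weight_marginal i (f : F -> R) :
  \sum_w prod_weight w * f (w i) = \sum_x mu i x * f x.
Proof.
pose G j x := mu j x * (if j == i then f x else 1).
transitivity (\sum_(w : {ffun I -> F}) \prod_j G j (w j)).
  apply: eq_bigr => w _; rewrite /G big_split /=; congr (_ * _).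
  by rewrite -big_mkcond big_pred1_eq.
rewrite -bigA_distr_bigA (bigD1 i) //= [X in _ * X]big1 ?mulr1.
  by apply: eq_bigr => x _; rewrite /G eqxx.
move=> j /negbTE ji; rewrite -[RHS](mu1 j); apply: eq_bigr => x _.
by rewrite /G ji mulr1.
Qed.

Variables (k s : nat) (b : I -> F -> 'rV[R]_k).

Definition sample_mx (w : {ffun I -> F}) : 'M[R]_k :=
  \sum_i (b i (w i))^T *m b i (w i).

Hypothesis isotropic : \sum_i \sum_x mu i x *: ((b i x)^T *m b i x) = 1%:M.

Lemma sample_mx_mean : \sum_w prod_weight w *: sample_mx w = 1%:M.
Proof.
rewrite -isotropic; under eq_bigr do rewrite scaler_sumr.
rewrite exchange_big; apply: eq_bigr => i _ /=; apply/matrixP => j l.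
rewrite !summxE; under eq_bigr do rewrite mxE.
under [RHS]eq_bigr do rewrite mxE.
exact: (prod_weight_marginal i (fun x => ((b i x)^T *m b i x) j l)).
Qed.

Definition sample_dev (w : {ffun I -> F}) : R := sparse_norm s (sample_mx w - 1%:M).

Lemma sample_dev_ge0 w : 0 <= sample_dev w. Proof. exact: sparse_norm_ge0. Qed.

(** The identity is the mean of an independent copy of the sample, and the norm of a mean is at most
    the mean of the norms. *)
Lemma sample_dev_le w : sample_dev w <=
  \sum_w' prod_weight w' * sparse_norm s (sample_mx w - sample_mx w').
Proof.
apply: sparse_norm_le => x Dx.
have -> : sample_mx w - 1%:M = \sum_w' prod_weight w' *: (sample_mx w - sample_mx w').
  under eq_bigr do rewrite scalerBr.
  by rewrite sumrB sample_mx_mean -scaler_suml sum_prod_weight scale1r.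
rewrite qform_sum; apply: (le_trans (ler_norm_sum _ _ _)).
apply: ler_sum => w' _; rewrite qformZ normrM ger0_norm ?prod_weight_ge0 //.
by rewrite ler_wpM2l ?prod_weight_ge0 // le_sparse_norm.
Qed.

(** Exchanges the draws of the two copies where [e] is [true]: the joint weight is preserved and the
    corresponding differences change sign. *)
Let swap (e : {ffun I -> bool}) (p : {ffun I -> F} * {ffun I -> F}) :=
  ([ffun i => if e i then p.2 i else p.1 i], [ffun i => if e i then p.1 i else p.2 i]).

Let swapK e : involutive (swap e).
Proof.
by move=> [w w']; congr pair; apply/ffunP => i; rewrite !ffunE /= ?ffunE; case: (e i).
Qed.

Local Notation outer i x := ((b i x)^T *m b i x).

Lemma swap_invariance (Phi : 'M[R]_k -> R) (e : {ffun I -> bool}) :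
  \sum_w \sum_w' prod_weight w * prod_weight w' * Phi (sample_mx w - sample_mx w') =
  \sum_w \sum_w' prod_weight w * prod_weight w' *
    Phi (\sum_i (-1) ^+ e i *: (outer i (w i) - outer i (w' i))).
Proof.
rewrite !pair_bigA /= (reindex_inj (inv_inj (swapK e))) /=.
apply: eq_bigr => -[w w'] _ /=; congr (_ * Phi _).
  rewrite /prod_weight -!big_split; apply: eq_bigr => i _ /=.
  by rewrite !ffunE; case: (e i); rewrite // mulrC.
rewrite /sample_mx -sumrB; apply: eq_bigr => i _; rewrite !ffunE.
by case: (e i); rewrite ?expr1 ?expr0 ?scale1r // scaleN1r opprB.
Qed.

(** The swap inserts any fixed signs [e]; convexity separates the two copies at the cost of [2 ^ n],
    and only then are the signs averaged. *)
Lemma symmetrization n : (0 < n)%N ->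
  \sum_w prod_weight w * sample_dev w ^+ n <=
  2 ^+ n * \sum_w prod_weight w * rad_avg (fun e =>
    sparse_norm s (\sum_i (-1) ^+ e i *: outer i (w i)) ^+ n).
Proof.
move=> n0.
pose H e w := sparse_norm s (\sum_i (-1) ^+ (e : {ffun I -> bool}) i *: outer i (w i)).
have H0 e w : 0 <= H e w by exact: sparse_norm_ge0.
pose S := \sum_w \sum_w' prod_weight w * prod_weight w' *
   sparse_norm s (sample_mx w - sample_mx w') ^+ n.
apply: (@le_trans _ _ S).
  apply: ler_sum => w _; rewrite /= ; under [leRHS]eq_bigr do rewrite -mulrA.
  rewrite -mulr_sumr ler_wpM2l ?prod_weight_ge0 //.
  apply: (@le_trans _ _ ((\sum_w' prod_weight w' *
      sparse_norm s (sample_mx w - sample_mx w')) ^+ n)).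
    rewrite lerXn2r ?nnegrE ?sample_dev_ge0 ?sample_dev_le //.
    by apply: sumr_ge0 => w' _; rewrite mulr_ge0 ?prod_weight_ge0 ?sparse_norm_ge0.
  apply: pow_jensen => // [w'||w']; rewrite ?prod_weight_ge0 ?sum_prod_weight //.
  exact: sparse_norm_ge0.
pose A e := \sum_w prod_weight w * H e w ^+ n.
have SA e : S <= 2 ^+ n * A e.
  rewrite /S (swap_invariance (fun Q => sparse_norm s Q ^+ n) e).
  have pt w w' : sparse_norm s (\sum_i (-1) ^+ e i *: (outer i (w i) - outer i (w' i))) ^+ n <=
      2 ^+ n * (2^-1 * H e w ^+ n + 2^-1 * H e w' ^+ n).
    apply: (@le_trans _ _ ((H e w + H e w') ^+ n)).
      rewrite lerXn2r ?nnegrE ?sparse_norm_ge0 ?addr_ge0 //.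
      under eq_bigr do rewrite scalerBr.
      by rewrite sumrB (le_trans (sparse_normD _ _ _)) // sparse_normN.
    have := @pow_jensen R bool (fun=> 2^-1) (fun t => if t then H e w else H e w') n n0.
    rewrite !big_bool /= => h.
    have -> : H e w + H e w' = 2 * (2^-1 * H e w + 2^-1 * H e w') by field.
    rewrite exprMn ler_wpM2l ?exprn_ge0 //; apply: h => //; last by case.
    by lra.
  apply: (@le_trans _ _ (\sum_w \sum_w' (2 ^+ n * 2^-1) *
     (prod_weight w * H e w ^+ n * prod_weight w' + prod_weight w * (prod_weight w' * H e w' ^+ n)))).
    apply: ler_sum => w _; apply: ler_sum => w' _.
    apply: (@le_trans _ _ (prod_weight w * prod_weight w' *
      (2 ^+ n * (2^-1 * H e w ^+ n + 2^-1 * H e w' ^+ n)))).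
      by rewrite ler_wpM2l ?mulr_ge0 ?prod_weight_ge0.
    by rewrite le_eqVlt; apply/orP; left; apply/eqP; ring.
  under eq_bigr do rewrite -mulr_sumr big_split /= -!mulr_sumr sum_prod_weight mulr1.
  rewrite -mulr_sumr big_split /= -mulr_suml sum_prod_weight mul1r -/(A e).
  by rewrite le_eqVlt; apply/orP; left; apply/eqP; field.
have -> : \sum_w prod_weight w * rad_avg (fun e => H e w ^+ n) = rad_avg A.
  rewrite /rad_avg /A; under eq_bigr do rewrite mulr_sumr.
  rewrite exchange_big; apply: eq_bigr => e _ /=; rewrite mulr_sumr.
  by apply: eq_bigr => w _; rewrite mulrCA.
rewrite -rad_avgZ.
rewrite -[leLHS]mul1r -[X in X * _ <= _](rad_avg1 R I) mulr_suml.
exact: (@le_rad_avg R I (fun=> S) _ SA).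
Qed.

End Symmetrization.

(** * Moment and tail of the deviation from isotropy *)

Section Tail.
Variables (R : realType) (I F J : finType) (mu : I -> F -> R).
Hypotheses (mu0 : forall i x, 0 <= mu i x) (mu1 : forall i, \sum_x mu i x = 1).
Variables (k s q : nat) (a : J -> 'rV[R]_k) (rho : I -> F -> J) (K t : R).
Let b i x := a (rho i x).
Hypothesis isotropic : \sum_i \sum_x mu i x *: ((b i x)^T *m b i x) = 1%:M.
Hypotheses (aK : forall j i, `|a j 0 i| <= K) (K0 : 0 < K).
Hypotheses (s2 : (2 <= s)%N) (sk : (s <= k)%N) (J2 : (2 <= #|J|)%N) (q0 : (0 < q)%N).
Hypothesis hq : ln (s%:R : R) ^+ 2 * ln (k%:R : R) * ln (#|J|%:R : R) <= q%:R.

(** The 8 collects the [2 ^ 2] of symmetrization at order [2 q] and a 2 that turns [V] into the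
    average of 1 and [Z]. *)
Let beta := 8 * (rad_sparse_cst R * (K ^+ 2 * s%:R * q%:R)).
Let beta0 : 0 <= beta.
Proof.
apply: mulr_ge0 => //; apply: mulr_ge0; first exact: ltW (rad_sparse_cst_gt0 R).
by apply: mulr_ge0 => //; apply: mulr_ge0 => //; exact: sqr_ge0.
Qed.

Let Z := sample_dev s b.
Let P := prod_weight mu.

(** As [V <= 1 + Z], symmetrization and the Rademacher bound give [E <= beta ^ q (1 + E)], and
    [beta ^ q <= 1/2] lets [E] be absorbed. *)
Lemma sample_dev_moment : 2 * beta <= 1 ->
  \sum_w P w * Z w ^+ (2 * q) <= 2 * beta ^+ q.
Proof.
move=> b1; set E := \sum_w _.
have P0 w : 0 <= P w by exact: prod_weight_ge0.
have E0 : 0 <= E by apply: sumr_ge0 => w _; rewrite mulr_ge0 ?exprn_ge0 ?sample_dev_ge0.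
have step : E <= beta ^+ q * (1 + E).
  have q20 : (0 < 2 * q)%N by rewrite muln_gt0.
  have sy := symmetrization mu0 mu1 s isotropic q20; rewrite /E; apply: (le_trans sy).
  rewrite -[X in _ * (X + _)](sum_prod_weight mu1) -/P /E -big_split /= !mulr_sumr.
  apply: ler_sum => w _.
  set V := sparse_norm s (sample_mx b w).
  have := @rademacher_sparse_norm R I J k s q a (fun i => rho i (w i)) K aK K0 s2 sk J2 q0 hq.
  rewrite -/(sample_mx b w) -/V => h.
  have VZ : V <= 1 + Z w.
    rewrite /V (_ : sample_mx b w = 1%:M + (sample_mx b w - 1%:M)); last by rewrite addrC subrK.
    by apply: (le_trans (sparse_normD _ _ _)); rewrite lerD2r sparse_norm1.
  have V0 : 0 <= V by exact: sparse_norm_ge0.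
  have Z0 : 0 <= Z w by exact: sample_dev_ge0.
  rewrite mulrCA (_ : P w + _ = P w * (1 + Z w ^+ (2 * q))); last by rewrite mulrDr mulr1.
  rewrite [leRHS]mulrCA ler_wpM2l //.
  apply: le_trans (ler_wpM2l (exprn_ge0 (2 * q) (ler0n R 2)) h) _.
  have -> : rad_sparse_cst R * (K ^+ 2 * s%:R * q%:R * V) = beta / 8 * V.
    by rewrite /beta; move: (rad_sparse_cst R) => u; field.
  rewrite exprM -exprMn.
  apply: (@le_trans _ _ ((beta * ((1 + Z w) / 2)) ^+ q)).
    have VZ2 : beta * (V / 2) <= beta * ((1 + Z w) / 2) by rewrite ler_wpM2l // ler_wpM2r.
    have -> : 2 ^+ 2 * (beta / 8 * V) = beta * (V / 2) by field.
    apply: lerXn2r => //; rewrite nnegrE; apply: mulr_ge0 => //; apply: divr_ge0 => //.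
    exact: addr_ge0.
  rewrite exprMn ler_wpM2l ?exprn_ge0 //.
  (* The average [(1 + Z) / 2] is at most 1 or, when [Z > 1], at most [Z ^ 2]. *)
  have [Z1|Z1] := leP (Z w) 1.
    apply: (@le_trans _ _ (1 ^+ q)).
      by rewrite lerXn2r ?nnegrE ?divr_ge0 ?addr_ge0 //; lra.
    by rewrite expr1n lerDl exprn_ge0.
  apply: (@le_trans _ _ (Z w ^+ (2 * q))); last by rewrite lerDr.
  rewrite exprM lerXn2r ?nnegrE ?divr_ge0 ?addr_ge0 ?exprn_ge0 //; nra.
have bq : beta ^+ q <= 2^-1.
  apply: (@le_trans _ _ beta); last by lra.
  by rewrite -[leRHS]expr1 ler_wiXn2l //; lra.
have := ler_wpM2r E0 bq; have : 0 <= beta ^+ q by rewrite exprn_ge0.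
nra.
Qed.

(** Markov's inequality at order [2 q]; the condition on [t] makes each of [q] factors at most
    [exp (- 1)]. *)
Lemma sample_dev_tail : 0 < t -> 2 * beta <= 1 -> 2 * beta <= t ^+ 2 * expR (- 1) ->
  \sum_(w | t < Z w) P w <= expR (- q%:R).
Proof.
move=> t0 b1 bt.
have P0 w : 0 <= P w by exact: prod_weight_ge0.
have tq : 0 < t ^+ (2 * q) by rewrite exprn_gt0.
rewrite -(ler_pM2l tq) mulr_sumr.
apply: (@le_trans _ _ (\sum_w P w * Z w ^+ (2 * q))).
  rewrite [leRHS](bigID (fun w => t < Z w)) /=.
  rewrite -[leLHS]addr0 lerD //.
    apply: ler_sum => w tw; rewrite mulrC ler_wpM2l // lerXn2r ?nnegrE ?(ltW t0) ?(ltW tw) //.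
    exact: sample_dev_ge0.
  by apply: sumr_ge0 => w _; rewrite mulr_ge0 ?exprn_ge0 // sample_dev_ge0.
apply: (le_trans (sample_dev_moment b1)).
apply: (@le_trans _ _ ((2 * beta) ^+ q)).
  by rewrite [leRHS]exprMn ler_wpM2r ?exprn_ge0 // -[leLHS]expr1 ler_eXn2l ?ltr1n.
have -> : expR (- q%:R) = expR (- 1) ^+ q :> R by rewrite -expRM_natl mulrN1.
rewrite exprM -exprMn; apply: lerXn2r => //; rewrite nnegrE; first exact: mulr_ge0.
by apply: mulr_ge0; [exact: sqr_ge0|exact: expR_ge0].
Qed.

End Tail.

(** * Gram matrix of the reweighted sampled matrix *)

Section Matrices.
Variables (R : realType).

Lemma RIP_const_le N k s (Phi : 'M[R]_(N, k)) :
  RIP_const Phi s <= sparse_norm s (Phi^T *m Phi - 1%:M).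
Proof.
have [_ _ h] := RIP_constP Phi s; apply: h; first exact: sparse_norm_ge0.
move=> z sz; have := le_sparse_norm_scale (Phi^T *m Phi - 1%:M) sz.
rewrite qformB qform1 (_ : qform (Phi^T *m Phi) z = l2norm (Phi *m z) ^+ 2).
  by rewrite ler_norml => /andP[h1 h2]; apply/andP; split; lra.
by rewrite -qform1 /qform trmx_mul mulmx1 !mulmxA.
Qed.

Variables (n k T : nat) (m : 'I_T -> nat) (p : 'I_T -> 'I_n -> R).
Hypotheses (p0 : forall t i, 0 < p t i) (m0 : forall t, (0 < m t)%N).
Variable Ub : 'I_T -> 'M[R]_(n, k).

(** The row produced by drawing the vertex [j.2] at time [j.1]. It is the same for all samples of
    that time, so there are only [n T] such rows. *)
Definition sample_row (j : 'I_T * 'I_n) : 'rV[R]_k :=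
  (p j.1 j.2 `^ (- 2^-1) * (m j.1)%:R^-1 `^ 2^-1) *: row j.2 (Ub j.1).

Lemma mxdiag_diagE (D : forall t, 'M[R]_(m t)) (r : 'I_(\sum_(t < T) m t)) :
  (\mxdiag_t D t) r r = D (tagnat.sig1 r) (tagnat.sig2 r) (tagnat.sig2 r).
Proof. by rewrite /mxdiag /mxblock mxE eqxx conform_mx_id. Qed.

(** A Gram matrix is the sum of the outer products of the rows; [tagnat.sig] matches row numbers
    with pairs of a time and a sample. *)
Lemma gram_sampled (x : forall t : 'I_T, 'I_(m t) -> 'I_n) :
  let Phi := Psi_mx p x *m sampling_mx R x *m \mxcol_t Ub t in
  Phi^T *m Phi = \sum_(ti : {t : 'I_T & 'I_(m t)})
    (sample_row (tag ti, x (tag ti) (tagged ti)))^T *m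
     sample_row (tag ti, x (tag ti) (tagged ti)).
Proof.
move=> Phi.
have PhiE r j : Phi r j = sample_row (tag (tagnat.sig r), x (tag (tagnat.sig r)) (tagged (tagnat.sig r))) 0 j.
  rewrite /Phi -mulmxA mul_mxblock_mxrow /Psi_mx /diag_powR mulmx_diag mul_diag_mx.
  rewrite [LHS]mxE [X in X * _]mxE [X in X * _ * _]mxE [X in _ * X * _]mxE !mxdiag_diagE.
  rewrite [X in _ = X]mxE; congr (_ * _).
    by rewrite [X in X `^ _ * _]mxE eqxx mulr1n mxE [X in _ * X `^ _]mxE eqxx mulr1n.
  rewrite [LHS]mxE summxE (bigD1 (tagnat.sig1 r)) //= eqxx big1 => [|t /negbTE tr].
    rewrite addr0 mxE (bigD1 (x (tagnat.sig1 r) (tagnat.sig2 r))) //= !mxE eqxx mul1r.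
    by rewrite big1 ?addr0 // => v /negbTE vx; rewrite mxE vx mul0r.
  by rewrite eq_sym tr mul0mx mxE.
apply/matrixP => i j; rewrite mxE summxE.
rewrite (reindex _ (@tagnat.sig_bij_on _ m)) /=.
by apply: eq_bigr => r _; rewrite [X in X * _]mxE !PhiE [RHS]mxE big_ord1 [X in _ = X * _]mxE.
Qed.

Lemma powR_half2 (x : R) : 0 <= x -> (x `^ 2^-1) ^+ 2 = x.
Proof. by move=> x0; rewrite powR12_sqrt // sqr_sqrtr. Qed.

(** The probability of a vertex cancels the squared weight [1 / p], and the [m t] samples of time
    [t] carry [1 / m t] each: in the mean every row counts once. *)
Lemma sample_row_isotropic :
  \sum_(ti : {t : 'I_T & 'I_(m t)}) \sum_v
    p (tag ti) v *: ((sample_row (tag ti, v))^T *m sample_row (tag ti, v)) =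
  \sum_t \sum_v (row v (Ub t))^T *m row v (Ub t).
Proof.
have E t v : p t v *: ((sample_row (t, v))^T *m sample_row (t, v)) =
    (m t)%:R^-1 *: ((row v (Ub t))^T *m row v (Ub t)).
  rewrite /sample_row /= [(_ *: row _ _)^T]linearZ /= -scalemxAl -scalemxAr !scalerA; congr (_ *: _).
  have a2 := powR_half2 (ltW (p0 t v)).
  have c0 : 0 <= (m t)%:R^-1 :> R by rewrite invr_ge0.
  have c2 := powR_half2 c0; rewrite powRN.
  set a := p t v `^ _ in a2 *; set c := _ `^ _ in c2 *.
  have an0 : a != 0 by apply/eqP => a0; have := p0 t v; rewrite -a2 a0 expr0n ltxx.
  by rewrite -a2 -c2; field.
transitivity (\sum_t \sum_(i < m t) \sum_v (m t)%:R^-1 *: ((row v (Ub t))^T *m row v (Ub t))).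
  rewrite (sig_big_dep _ (fun _ _ => true) (fun t i => \sum_v (m t)%:R^-1 *: ((row v (Ub t))^T *m row v (Ub t)))) /=.
  apply: eq_bigr => -[t i] _ /=.
  by apply: eq_bigr => v _; rewrite E.
apply: eq_bigr => t _; rewrite sumr_const card_ord -scaler_sumr scalerMnl.
rewrite -[X in X *: _]mulr_natl mulfV ?scale1r // pnatr_eq0 -lt0n //.
Qed.

Lemma norm_sample_row t v i :
  `|sample_row (t, v) 0 i| = `|Ub t v i| / Num.sqrt (p t v) / Num.sqrt (m t)%:R.
Proof.
rewrite !mxE /= powRN normrM normrM normfV.
rewrite (ger0_norm (powR_ge0 _ _)) (ger0_norm (powR_ge0 _ _)).
rewrite powR12_sqrt ?(ltW (p0 _ _)) // powR12_sqrt ?invr_ge0 // sqrtrV //.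
by rewrite mulrC mulrA.
Qed.

End Matrices.

(** * Orthonormality of the space-time matrix *)

Section Orthonormal.
Variables (R : realType) (n k T : nat) (lekn : (k <= n)%N).
Variables (lam : 'I_n -> R) (u : 'I_n -> 'cV[R]_n).
Hypotheses (T0 : (0 < T)%N).
Hypothesis uo : forall i j, ((u i)^T *m u j) 0 0 = (i == j)%:R.

Definition Ublock (t : 'I_T) : 'M[R]_(n, k) := \matrix_(i < n, j < k)
  (lam (widen_ord lekn j) ^+ t / fT T (lam (widen_ord lekn j))
     * u (widen_ord lekn j) i 0).

(** Summing over vertices uses the orthonormality of [u]; on the diagonal, the sum over times is
    [fT ^ 2], cancelled by the normalization. *)
Lemma Utilde_orthonormal :
  \sum_t \sum_v (row v (Ublock t))^T *m row v (Ublock t) = 1%:M.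
Proof.
apply/matrixP => i j; rewrite summxE.
pose c l (t : 'I_T) : R := lam (widen_ord lekn l) ^+ t / fT T (lam (widen_ord lekn l)).
have row_t t : (\sum_v (row v (Ublock t))^T *m row v (Ublock t)) i j =
    c i t * c j t * (i == j)%:R.
  have -> : (i == j)%:R = ((u (widen_ord lekn i))^T *m u (widen_ord lekn j)) 0 0 by rewrite uo.
  rewrite summxE [X in _ = _ * X]mxE mulr_sumr; apply: eq_bigr => v _.
  by rewrite mxE big_ord1 !mxE -/(c i t) -/(c j t); ring.
under eq_bigr do rewrite row_t.
rewrite mxE -mulr_suml; case: eqP => [->|_]; last by rewrite mulr0.
rewrite mulr1 /c; set l := lam _.
(* The term of time 0 equals 1. *)
have S0 : 0 < \sum_(t < T) l ^+ (2 * t).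
  case: T T0 => // T' _; rewrite big_ord_recl /= muln0 expr0 ltr_pwDl //.
  by apply: sumr_ge0 => t _; rewrite exprM exprn_ge0 // sqr_ge0.
have f0 : fT T l != 0 by rewrite gt_eqF // sqrtr_gt0.
have f2 : fT T l ^+ 2 = \sum_(t < T) l ^+ (2 * t) by rewrite sqr_sqrtr // ltW.
under eq_bigr => t _.
  rewrite (_ : _ * _ = l ^+ (2 * t) / fT T l ^+ 2); last first.
    by rewrite mulnC exprM; field.
  over.
by rewrite -mulr_suml f2 mulfV // gt_eqF.
Qed.

End Orthonormal.

(** * Law of a random element of a finite set *)

Section FiniteLaw.
Local Open Scope classical_set_scope.
Variables (R : realType) (d : measure_display) (Om : measurableType d).
Variable P : probability Om R.

Lemma prob_finite (S : finType) (X : Om -> S) (f : S -> R) (Q : pred S) :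
  (forall w, measurable (X @^-1` [set w])) ->
  (forall w, P (X @^-1` [set w]) = (f w)%:E) ->
  P [set o | Q (X o)] = (\sum_(w | Q w) f w)%:E.
Proof.
move=> mX PX.
have -> : [set o | Q (X o)] = \bigcup_(w in [set w | Q w]) X @^-1` [set w].
  apply/seteqP; split=> o /=; first by move=> Qo; exists (X o).
  by move=> [w /= Qw ->].
rewrite measure_fin_bigcup //.
- rewrite (eq_fsbigr (fun w => (f w)%:E)); last by move=> w _; exact: PX.
  rewrite (fsbigE (enum Q)) ?enum_uniq //.
  + rewrite big_enum_cond sumEFin; congr EFin; apply: eq_bigl => w.
    rewrite andbC; have [Qw|Qw] := boolP (Q w).
      by rewrite mem_set // inE.
    by rewrite [_ \in mem Q](negbTE Qw) andbF.
  + by move=> w /=; rewrite mem_enum.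
  + by move=> w /= Qw; rewrite mem_enum => /negP.
- exact: finite_finset.
- by move=> w w' _ _ [y []] /= <- <-.
Qed.

End FiniteLaw.

(** * Choice of the constants and proof of the sampling theorem *)

Local Open Scope classical_set_scope.
Local Open Scope ring_scope.

Theorem theorem3 (R : realType) :
  exists C : R, 0 < C /\
  forall (n k s T : nat) (lekn : (k <= n)%N) (w : 'M[R]_n)
    (sigma : 'I_n -> R) (u : 'I_n -> 'cV[R]_n) (dt : R)
    (m : 'I_T -> nat) (p : 'I_T -> 'I_n -> R)
    (d : measure_display) (Om : measurableType d) (P : probability Om R)
    (omega : forall t : 'I_T, 'I_(m t) -> Om -> 'I_n) (delta : R),
  (1 <= s)%N -> (s <= k)%N -> (1 <= T)%N ->
  weighted_graph w -> connected_graph w ->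
  simple_eigensystem (laplacian w) sigma u ->
  0 < dt ->
  (forall t, (1 <= m t)%N) ->
  (forall t, prob_vector (p t)) -> (forall t i, 0 < p t i) ->
  random_samples P p omega ->
  0 < delta < 1 ->
  let U := Utilde T lekn (diffusion_eigenvalue dt sigma) u in
  (forall t : 'I_T,
     C * coherence U p t ^+ 2 * delta ^- 2 * s%:R
       * ln (s%:R : R) ^+ 2 * ln (k%:R : R) * ln ((n * T)%:R : R)
     <= (m t)%:R) ->
  ((1 - (n * T)%:R `^ (- (ln (s%:R : R) ^+ 2 * ln (k%:R : R))))%:E
   <= P [set o | (RIP_const
                    (Psi_mx p (fun t i => omega t i o)
                     *m sampling_mx R (fun t i => omega t i o) *m U) s
                  <= 3 * delta)%R])%E.
Proof.
pose rc := rad_sparse_cst R.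
have rc0 : 0 < rc by exact: rad_sparse_cst_gt0.
(* [272 = 16 * 17]: 16 from [2 * beta] and 17 from rounding [L'] up to [q]; [expR 1] compensates the
   [expR (- 1)] of the tail bound. *)
exists (272 * rc * expR 1); split; first by rewrite !mulr_gt0 ?expR_gt0.
set C := 272 * rc * expR 1.
have C0 : 0 < C by rewrite !mulr_gt0 ?expR_gt0.
move=> n k s T lekn wt sigma u dt m p d Om P omega delta s1 sk T0 _ _ [_ _ _ uo] _ m0
  pv p0 [omM omP omI] /andP[d0 d1] U hm.
(* For [s = 1] the logarithm vanishes and the claimed probability is [1 - 1 = 0]. *)
have [s2|s2] := ltnP 1 s; last first.
  have -> : s = 1%N by apply/eqP; rewrite eqn_leq s2.
  by rewrite ln1 expr0n mul0r oppr0 powRr0 subrr measure_ge0.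
have k2 : (2 <= k)%N := leq_trans s2 sk.
have n2 : (2 <= n)%N := leq_trans k2 lekn.
have nT2 : (2 <= n * T)%N by rewrite (leq_trans n2) // leq_pmulr.
set lam := diffusion_eigenvalue dt sigma in U hm *.
pose Ub (t : 'I_T) := Ublock lekn lam u t.
have UE : U = \mxcol_t Ub t by [].
pose I : finType := {t : 'I_T & 'I_(m t)}.
pose J : finType := ('I_T * 'I_n)%type.
pose a : J -> 'rV[R]_k := sample_row m p Ub.
pose rho (i : I) (v : 'I_n) : J := (tag i, v).
pose mu (i : I) (v : 'I_n) := p (tag i) v.
have mu0 i v : 0 <= mu i v by exact: ltW (p0 _ _).
have mu1 i : \sum_v mu i v = 1 by exact: (pv (tag i)).2.
have iso : \sum_i \sum_v mu i v *: ((a (rho i v))^T *m a (rho i v)) = 1%:M.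
  by rewrite (sample_row_isotropic p0 m0) Utilde_orthonormal.
pose ls := ln (s%:R : R); pose lk := ln (k%:R : R); pose lN := ln ((n * T)%:R : R).
have hls : 2^-1 <= ls by exact: half_le_ln.
have hlk : 2^-1 <= lk by exact: half_le_ln.
have hlN : 2^-1 <= lN by exact: half_le_ln.
pose L' := ls ^+ 2 * lk * lN.
have hL : 16^-1 <= L'.
  have h1 : 4^-1 <= ls ^+ 2.
    by rewrite (_ : 4^-1 = 2^-1 ^+ 2 :> R); [rewrite lerXn2r ?nnegrE //; lra|field].
  have h2 : 8^-1 <= ls ^+ 2 * lk.
    by rewrite (_ : 8^-1 = 4^-1 * 2^-1 :> R); [rewrite ler_pM|field].
  by rewrite (_ : 16^-1 = 8^-1 * 2^-1 :> R); [rewrite ler_pM|field].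
have L0 : 0 < L' by apply: lt_le_trans hL; rewrite invr_gt0.
(* Since [L' >= 1/16], the bound [q <= L' + 1] costs at most a factor 17. *)
pose q := (Num.trunc L').+1.
have q1 : L' <= q%:R by rewrite ltW // truncnS_gt.
have q2 : q%:R <= 17 * L'.
  have h : (Num.trunc L')%:R <= L' by rewrite truncn_le ltW.
  rewrite /q -[X in X%:R <= _]addn1 natrD.
  lra.
have sR : 0 < s%:R :> R by rewrite ltr0n ltnW.
have D0 : 0 < C * s%:R * L' by apply: mulr_gt0 => //; apply: mulr_gt0.
(* The bound on the entries of the rescaled rows that the assumption on [m] guarantees at all
   times. *)
pose K := delta / Num.sqrt (C * s%:R * L').
have K0 : 0 < K by rewrite divr_gt0 // sqrtr_gt0.
have K2 : K ^+ 2 = delta ^+ 2 / (C * s%:R * L').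
  by rewrite exprMn exprVn sqr_sqrtr // ltW.
have aK j i : `|a j 0 i| <= K.
  case: j => t v; rewrite /a norm_sample_row //.
  set x := `|_| / _; have mt0 : 0 < (m t)%:R :> R by rewrite ltr0n.
  have x0 : 0 <= x by rewrite divr_ge0 // sqrtr_ge0.
  have xc : x <= coherence U p t.
    rewrite /coherence UE mxcolK.
    apply: (@le_trans _ _ (\big[Num.max/0]_(j < k) (`|Ub t v j| / Num.sqrt (p t v)))).
      exact: (le_bigmax 0 (fun j => `|Ub t v j| / Num.sqrt (p t v)) i).
    exact: (le_bigmax 0 (fun v => \big[Num.max/0]_(j < k) (`|Ub t v j| / Num.sqrt (p t v))) v).
  rewrite -(@ler_pXn2r _ 2) ?nnegrE ?(ltW K0) ?divr_ge0 ?sqrtr_ge0 //.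
  rewrite K2 exprMn exprVn sqr_sqrtr ?(ltW mt0) // ler_pdivrMr //.
  rewrite mulrAC ler_pdivlMr //.
  have x2 : x ^+ 2 <= coherence U p t ^+ 2 by rewrite lerXn2r ?nnegrE // (le_trans x0).
  apply: (le_trans (ler_wpM2r (ltW D0) x2)).
  have := hm t; rewrite -/ls -/lk -/lN => h.
  have d2 : 0 < delta ^+ 2 by rewrite exprn_gt0.
  rewrite -(ler_pM2l d2) in h; apply: le_trans h.
  rewrite le_eqVlt; apply/orP; left; apply/eqP; rewrite /L'.
  by field; rewrite gt_eqF.
have J2 : (2 <= #|J|)%N by rewrite card_prod !card_ord mulnC.
have hq : ls ^+ 2 * lk * ln (#|J|%:R : R) <= q%:R.
  by rewrite card_prod !card_ord mulnC.
have q0 : (0 < q)%N by [].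
set beta := 8 * (rad_sparse_cst R * (K ^+ 2 * s%:R * q%:R)).
have hb : 2 * beta <= delta ^+ 2 * expR (- 1).
  rewrite expRN ler_pdivlMr ?expR_gt0 //.
  have -> : 2 * beta * expR 1 = 16 * rc * expR 1 * (K ^+ 2 * s%:R) * q%:R.
    by rewrite /beta -/rc; ring.
  have c0 : 0 <= 16 * rc * expR 1 * (K ^+ 2 * s%:R).
    by rewrite !mulr_ge0 ?exprn_ge0 ?expR_ge0 // ltW.
  apply: (le_trans (ler_wpM2l c0 q2)).
  rewrite K2 /C le_eqVlt; apply/orP; left; apply/eqP.
  by field; rewrite !gt_eqF ?expR_gt0.
have e1 : expR (- 1) <= 1 :> R by rewrite -expR0 ler_expR oppr_le0.
have dd : delta ^+ 2 <= 1 by rewrite expr_le1 // ltW.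
have b1 : 2 * beta <= 1.
  by apply: (le_trans hb); apply: mulr_ile1; rewrite ?sqr_ge0 ?expR_ge0.
have b2 : 2 * beta <= (3 * delta) ^+ 2 * expR (- 1).
  apply: (le_trans hb); rewrite ler_wpM2r ?expR_ge0 // exprMn ler_peMl ?sqr_ge0 //.
  by rewrite expr_ge1 // ler1n.
have t0 : 0 < 3 * delta by rewrite mulr_gt0.
have tail := @sample_dev_tail R I 'I_n J mu mu0 mu1 k s q a rho K (3 * delta)
  iso aK K0 s2 sk J2 q0 hq t0 b1 b2.
pose sel (x : {ffun I -> 'I_n}) (t : 'I_T) (i : 'I_(m t)) : 'I_n :=
  x (existT (fun t : 'I_T => 'I_(m t) : Type) t i).
pose Phi (x : {ffun I -> 'I_n}) :=
  Psi_mx p (sel x) *m sampling_mx R (sel x) *m U.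
have gramE x : sample_mx (fun i v => a (rho i v)) x = (Phi x)^T *m Phi x.
  rewrite /Phi UE gram_sampled; apply: eq_bigr => -[t i] _.
  by rewrite /a /rho /sel.
pose Q x := RIP_const (Phi x) s <= 3 * delta.
pose X (o : Om) : {ffun I -> 'I_n} := [ffun i => omega (tag i) (tagged i) o].
have -> : [set o | (RIP_const
                    (Psi_mx p (fun t i => omega t i o)
                     *m sampling_mx R (fun t i => omega t i o) *m U) s
                  <= 3 * delta)%R] = [set o | Q (X o)].
  have selX o : sel (X o) = fun t i => omega t i o.
    by apply: functional_extensionality_dep => t; apply/funext => i; rewrite /sel ffunE.
  by apply/seteqP; split=> o; rewrite /Q /Phi /= selX.
(* Fibres of the joint sample are intersections over all indices, whence by independence its law is
   the product weight. *)
have XE x : X @^-1` [set x] =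
    \bigcap_(i in [set` [set: I]%SET]) (omega (tag i) (tagged i) @^-1` [set x i]).
  apply/seteqP; split=> o /=.
    by move=> <- i _; rewrite /= ffunE.
  move=> h; apply/ffunP => i; rewrite ffunE; apply: h.
  by rewrite /= inE.
rewrite (@prob_finite R d Om P _ X (prod_weight mu) Q).
- rewrite lee_fin -[X in X - _](sum_prod_weight mu1) (bigID Q) /= lerBlDr lerD2l.
  (* Failure of [Q] forces the deviation above [3 * delta], as it dominates the isometry
     constant. *)
  apply: (@le_trans _ _ (\sum_(x | 3 * delta < sample_dev s (fun i v => a (rho i v)) x)
      prod_weight mu x)).
    rewrite [leRHS](bigID Q) /= -[leLHS]add0r lerD //.
      by apply: sumr_ge0 => x _; exact: prod_weight_ge0.
    rewrite le_eqVlt; apply/orP; left; apply/eqP; apply: eq_bigl => x.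
    rewrite /Q -ltNge; case: ltP => //= h; last by rewrite andbF.
    rewrite andbT; symmetry; apply: (lt_le_trans h); apply: (le_trans (RIP_const_le _ _)).
    by rewrite /sample_dev gramE.
  apply: (le_trans tail).
  (* The power of [n T] is [exp (- L')], and [L' <= q]. *)
  rewrite /powR gt_eqF ?ltr0n ?(ltnW nT2) //.
  by rewrite ler_expR -/ls -/lk -/lN mulNr lerN2.
- move=> x; rewrite XE; apply: fin_bigcap_measurable => //.
  by move=> i _; apply: omM.
- move=> x; rewrite XE omI.
  under eq_bigr do rewrite omP.
  by rewrite prodEFin; congr EFin; apply: eq_bigl => i; rewrite inE.
Qed.
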